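(* For every $n\in\mathbb N$ the symmetric matrix-valued Gegenbauer polynomials satisfy $$x\left[\frac{d\hat P^{(\nu)}_n}{dx}(x),B_1\right]+\frac{d\hat P^{(\nu)}_n}{dx}(x)B_0-B_0^t\frac{d\hat P^{(\nu)}_n}{dx}(x)=[2A_0^{(\nu)}+nB_1,\hat P^{(\nu)}_n(x)].$$ Furthermore, the matrices $F^{(\nu)}_{k,n}$ satisfy, for all $n\in\mathbb N$ and all integers $k\le n$, $$\left[\frac{F^{(\nu)}_{k-2,n}}{\nu+2\ell+n-k+2},(2-k+2\nu+4\ell)B_1-2A^{(\nu)}_0\right]+\left[\frac{F^{(\nu)}_{k,n}}{\nu+2\ell+n-k},(2n-k)B_1+2A^{(\nu)}_0\right]=2\bigl(B_0^tF^{(\nu)}_{k-1,n}-F^{(\nu)}_{k-1,n}B_0\bigr).$$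
   Context: $\mathbb N=\{0,1,2,\dots\}$; $\ell\in\frac12\mathbb N$ with $\ell>0$ and real $\nu>0$ are fixed. $(a)_k=a(a+1)\cdots(a+k-1)$ is the Pochhammer symbol. The scalar Gegenbauer polynomials are $C_n^{(\nu)}(x)=\sum_{k=0}^{\lfloor n/2\rfloor}(-1)^k\frac{\Gamma(\nu+n-k)}{k!\,(n-2k)!\,\Gamma(\nu)}(2x)^{n-2k}$. All matrices have size $(2\ell+1)\times(2\ell+1)$, with rows and columns indexed by $0,1,\dots,2\ell$; $\mathbf 1$ is the identity matrix, $E_{i,j}$ the matrix unit with $1$ in position $(i,j)$, ${}^t$ the transpose, and $[X,Y]=XY-YX$. Matrix weight: for $x\in(-1,1)$, $W^{(\nu)}(x)$ is the (symmetric, positive definite) matrix with entries $$(W^{(\nu)}(x))_{i,j}=(1-x^2)^{\nu-\frac12}\sum_{k=\max(0,i+j-2\ell)}^{\min(i,j)}\alpha_k(i,j)\,C^{(\nu)}_{i+j-2k}(x),$$ $$\alpha_k(i,j)=(-1)^k\frac{i!\,j!\,(i+j-2k)!}{k!\,(2\nu)_{i+j-2k}(\nu)_{i+j-k}}\,\frac{(\nu)_{i-k}(\nu)_{j-k}}{(i-k)!\,(j-k)!}\,\frac{i+j-2k+\nu}{i+j-k+\nu}\,\frac{(2\ell-i)!\,(2\ell-j)!}{(2\ell+k-i-j)!}\,(-2\ell-\nu)_k\,\frac{2\ell+\nu}{(2\ell)!}.$$ The monic matrix-valued Gegenbauer polynomials $P_n^{(\nu)}(x)=x^n\mathbf 1+(\text{lower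 order terms with matrix coefficients})$, $n\in\mathbb N$, are the unique monic matrix polynomials with $\int_{-1}^1P_n^{(\nu)}(x)W^{(\nu)}(x)P_m^{(\nu)}(x)^{*}\,dx=0$ for $n\neq m$. The symmetric matrix-valued Gegenbauer polynomials are $\hat P_n^{(\nu)}(x)=D_n^{(\nu)}P_n^{(\nu)}(x)$, where $D_n^{(\nu)}$ is the diagonal matrix with $(D_n^{(\nu)})_{i,i}=\binom{2\ell}{i}\frac{(\nu+n)_i}{(\nu+n+2\ell-i)_i}$. The matrices $B_0,B_1,A_0^{(\nu)}$ are defined by $$2\ell\,B_0=\sum_{i=0}^{2\ell-1}(2\ell-i)E_{i,i+1}-\sum_{i=1}^{2\ell}i\,E_{i,i-1},\qquad \ell\,B_1=-\sum_{i=0}^{2\ell}(\ell-i)E_{i,i},$$ $$\ell\,A_0^{(\nu)}=\sum_{i=0}^{2\ell}\bigl((\ell+1)(i-2\ell)-(\nu-1)(\ell-i)\bigr)E_{i,i}.$$ For $0\le k\le\min(n,2\ell)$ the matrix $F^{(\nu)}_{k,n}$ has entries $(F^{(\nu)}_{k,n})_{i,j}=\frac{n!\,\Gamma(\nu+2\ell)}{2^n}\gamma(\nu+n;i,j,k)$, where $$\gamma(\nu;i,j,k)=(-1)^k(\nu+2\ell)(\nu+2\ell-k)\binom{2\ell}{k}\binom{k}{\frac12(k+i-j)}\binom{2\ell-k}{\frac12(i+j-k)}\frac{\Gamma(\nu-\frac12(k-i-j))\,\Gamma(\nu+2\ell-\frac12(k+i+j))}{\Gamma(\nu)\,\Gamma(\nu+2\ell+1-\frac12(k-i+j))\,\Gamma(\nu+2\ell+1-\frac12(k+i-j))}$$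 if $i+j\equiv k\pmod2$ and $\gamma(\nu;i,j,k)=0$ otherwise. Binomial coefficients $\binom ab$ are zero unless $0\le b\le a$, and $\gamma$ is zero whenever a binomial factor vanishes. Convention: $F^{(\nu)}_{k,n}=0$ for $k<0$ or $k>\min(n,2\ell)$. *)

(* Defs.v *)
From HB Require Import structures.
From mathcomp Require Import all_boot all_order all_algebra.
From mathcomp Require Import complex.
From mathcomp Require Import all_classical all_reals all_analysis.

Set Implicit Arguments.
Unset Strict Implicit.
Unset Printing Implicit Defensive.

Import Order.TTheory GRing.Theory Num.Theory.

Local Open Scope classical_set_scope.
Local Open Scope ring_scope.
Local Open Scope complex_scope.
Local Open Scope sesquilinear_scope.

(* The half-integer $\ell > 0$ is encoded by the natural number $L = 2\ell > 0$,
   so that matrices have size $L + 1$ and are indexed by $0, \dots, L$. *)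
Definition ell (R : realType) (L : nat) : R := L%:R / 2.

Definition poch (R : realType) (a : R) (k : nat) : R :=
  \prod_(m < k) (a + m%:R).

(* Euler's integral; it is the Gamma function for $z > 0$ only, which covers
   every nonvanishing term below. *)
Definition Gamma (R : realType) (z : R) : R :=
  \int[lebesgue_measure]_(t in `]0, +oo[) (t `^ (z - 1) * expR (- t)).

Definition gegenbauer (R : realType) (nu : R) (n : nat) (x : R) : R :=
  \sum_(k < n./2.+1)
    (-1) ^+ k * (Gamma (nu + n%:R - k%:R) / (k`!%:R * (n - 2 * k)`!%:R * Gamma nu))
    * (2 * x) ^+ (n - 2 * k).

(* Used for $\max(0, i+j-L) \le k \le \min(i, j)$ only, so that no subtraction
   of natural numbers is truncated. *)
Definition alpha (R : realType) (nu : R) (L k i j : nat) : R :=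
  (-1) ^+ k
  * ((i`!%:R * j`!%:R * (i + j - 2 * k)`!%:R)
     / (k`!%:R * poch (2 * nu) (i + j - 2 * k) * poch nu (i + j - k)))
  * (poch nu (i - k) * poch nu (j - k) / ((i - k)`!%:R * (j - k)`!%:R))
  * (((i + j - 2 * k)%:R + nu) / ((i + j - k)%:R + nu))
  * ((L - i)`!%:R * (L - j)`!%:R / (L + k - (i + j))`!%:R)
  * poch (- L%:R - nu) k * ((L%:R + nu) / L`!%:R).

(* The lower summation bound $\max(0, i+j-L)$ is the truncated difference. *)
Definition weight (R : realType) (nu : R) (L : nat) (x : R) : 'M[R]_L.+1 :=
  \matrix_(i, j)
    ((1 - x ^+ 2) `^ (nu - 2^-1)
     * \sum_(i + j - L <= k < (minn i j).+1)
         alpha nu L k i j * gegenbauer nu (i + j - 2 * k) x).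

Definition mxC (R : realType) (n : nat) (M : 'M[R]_n) : 'M[R[i]]_n :=
  map_mx (real_complex R) M.

Definition mx_integral (R : realType) (n : nat) (D : set R)
    (M : R -> 'M[R[i]]_n) : 'M[R[i]]_n :=
  \matrix_(i, j)
    ((\int[lebesgue_measure]_(x in D) complex.Re (M x i j))
     +i* (\int[lebesgue_measure]_(x in D) complex.Im (M x i j))).

(* Polynomials have matrix coefficients; evaluating at the central element
   [x%:M] substitutes the scalar [x] for the indeterminate. *)
Definition monic_mvGegenbauer (R : realType) (nu : R) (L : nat)
    (P : nat -> {poly 'M[R[i]]_L.+1}) : Prop :=
  (forall n, P n \is monic /\ size (P n) = n.+1) /\
  (forall n m, n <> m ->
     mx_integral `]-1, 1[
       (fun x => (P n).[(x%:C)%:M] *m mxC (weight nu L x) *m (P m).[(x%:C)%:M] ^t*)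
     = 0).

Definition Dmx (R : realType) (nu : R) (L n : nat) : 'M[R]_L.+1 :=
  diag_mx (\row_(i < L.+1)
    ('C(L, i)%:R * (poch (nu + n%:R) i / poch (nu + n%:R + L%:R - i%:R) i))).

Definition sym_mvGegenbauer (R : realType) (nu : R) (L : nat)
    (P : nat -> {poly 'M[R[i]]_L.+1}) (n : nat) : {poly 'M[R[i]]_L.+1} :=
  mxC (Dmx nu L n) *: P n.

Definition B0 (R : realType) (L : nat) : 'M[R]_L.+1 :=
  (2 * ell R L)^-1 *:
    \matrix_(i, j) (if j == i.+1 :> nat then 2 * ell R L - i%:R
                    else if i == j.+1 :> nat then - i%:R else 0).

Definition B1 (R : realType) (L : nat) : 'M[R]_L.+1 :=
  (ell R L)^-1 *: - diag_mx (\row_(i < L.+1) (ell R L - i%:R)).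

Definition A0 (R : realType) (nu : R) (L : nat) : 'M[R]_L.+1 :=
  (ell R L)^-1 *:
    diag_mx (\row_(i < L.+1) ((ell R L + 1) * (i%:R - 2 * ell R L)
                              - (nu - 1) * (ell R L - i%:R))).

Definition mxcomm (R : pzRingType) (n : nat) (X Y : 'M[R]_n) : 'M[R]_n :=
  X *m Y - Y *m X.

Definition binz (a b : int) : nat :=
  if 0 <= b <= a then 'C(`|a|, `|b|)%N else 0%N.

(* The integer divisions by 2 are exact under the parity condition. *)
Definition gam (R : realType) (nu : R) (L i j : nat) (k : int) : R :=
  let l := ell R L in
  let kr : R := k%:~R in
  if ((i%:Z + j%:Z)%R == k %[mod 2])%Z then
    (-1) ^ k * (nu + 2 * l) * (nu + 2 * l - kr)
    * (binz L k)%:R * (binz k ((k + i%:Z - j%:Z) %/ 2)%Z)%:R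
    * (binz (L%:Z - k) ((i%:Z + j%:Z - k) %/ 2)%Z)%:R
    * (Gamma (nu - (kr - i%:R - j%:R) / 2)
       * Gamma (nu + 2 * l - (kr + i%:R + j%:R) / 2)
       / (Gamma nu * Gamma (nu + 2 * l + 1 - (kr - i%:R + j%:R) / 2)
          * Gamma (nu + 2 * l + 1 - (kr + i%:R - j%:R) / 2)))
  else 0.

Definition Fmx (R : realType) (nu : R) (L : nat) (k : int) (n : nat) :
    'M[R]_L.+1 :=
  if 0 <= k <= (minn n L)%:Z then
    \matrix_(i, j) (n`!%:R * Gamma (nu + 2 * ell R L) / 2 ^+ n
                    * gam (nu + n%:R) L i j k)
  else 0.

(* Main.v *)
(* Write W = (1 - x^2)^(nu - 1/2) Z, L = 2 l and Q_n for the polynomial matrix with entries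
   sum_k (F_(k,n))_(i,j) C_(n-k)^(nu+L).  The entries of F_(k,n) factor into
   rising and falling factorials of (i+j-k)/2, (k+i-j)/2, ..., hence satisfy two contiguous
   relations in k and j.  These relations minus their transposes (F_(k,n) is
   symmetric) are the second identity.  They also show that Q_n is an eigenfunction, with
   diagonal matrix eigenvalues acting from the left, of a first order operator
   P |-> P' (x l B_1 + l B_0) + P l A_0 and of a second order one, both acting from the right.
   The contiguous relations of the coefficients of W and the Pearson equation of the scalar
   weight show that the two operators are symmetric for <P, Q> = int P W Q^T.  The joint
   eigenvalues of Q_n and Q_m are distinct for n <> m, so the Q_n are orthogonal.
   The coefficient of x^L in Z is invertible, which makes the pairing nondegenerate, and
   therefore P_n = D_n^-1 Q_n, i.e. Q_n is the symmetric polynomial.  As Q_n^T = Q_n, the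
   first order eigenvalue equation minus its transpose is the first identity. *)
Require Import Defs.
From HB Require Import structures.
From mathcomp Require Import all_boot all_order all_algebra.
From mathcomp Require Import complex.
From mathcomp Require Import all_classical all_reals all_analysis.
From mathcomp Require Import measurable_realfun ring lra zify.

Set Implicit Arguments.
Unset Strict Implicit.
Unset Printing Implicit Defensive.

Import Order.TTheory GRing.Theory Num.Theory.
Import numFieldNormedType.Exports.

Local Open Scope ring_scope.

(** * Integration over open intervals *)

Section integration_on_open_intervals.
Local Open Scope classical_set_scope.

(** The first order operator alone does not separate degrees: where 2 i = L its eigenvalue does not
    depend on n. This is why a second operator is needed. Symmetry of either operator amounts to
    writing the difference of two integrands as the derivative of (1 - x^2)^(nu + 1/2) times a
    polynomial. The commutators of Z with diagonal matrices must then be such derivatives. By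
    Gegenbauer's equation every C_m with m > 0 is one. The constant C_0 is not, but it occurs only
    on the diagonal, where the commutator vanishes. The parameter nu + L of the C_(n-k) in Q_n fits
    the factor nu + n + L - k of F_(k,n): it is what 2 (m + mu) C_m = C_(m+1)' - C_(m-1)' needs for
    m = n - k and mu = nu + L. The given P_n may have complex coefficients and are paired with
    conjugate transposes, whereas the analysis is real. Their real and imaginary parts are treated
    by one real-linear map, and strong induction on n shows the imaginary parts to be 0. *)

Lemma integral_gt0_near (R : realType) (D : set R) (f : R -> R) (x : R) :
  measurable D -> measurable_fun D f -> nbhs x D -> {for x, continuous f} ->
  (forall y, D y -> 0 <= f y) -> 0 < f x ->
  (0 < \int[@lebesgue_measure R]_(y in D) (f y)%:E)%E.
Proof.
move=> mD mf Dx cfx f0 fx0.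
have /nbhs_ballP[e/= e0 sub] : \forall y \near x, D y /\ f x / 2 < f y.
  near=> y; split; first by near: y.
  near: y; apply: (cvgr_gt (f x)) => //; rewrite ltr_pdivrMr ?ltr0n//.
  by rewrite mulr2n mulrDr mulr1 ltrDl.
(* With half the radius the closed segment stays inside the open ball. Its length e times f(x) / 2
   bounds the integral from below. *)
pose K : set R := `[x - e / 2, x + e / 2]%classic.
have mK : measurable K by exact: measurable_itv.
have KD y : K y -> D y /\ f x / 2 < f y.
  rewrite /K /= in_itv/= => /andP[yl yu]; apply: sub.
  by rewrite -ball_normE/= ltr_norml; apply/andP; split; lra.
have KsubD : K `<=` D by move=> y /KD[].
apply: (@lt_le_trans _ _ (\int[@lebesgue_measure R]_(y in K) (f x / 2)%:E)%E).
  rewrite integral_cst//= /K/= (@lebesgue_measure_itv R `[x - e / 2, x + e / 2]%R) /= lte_fin.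
  have xe : x - e / 2 < x + e / 2 by lra.
  by rewrite xe -EFinB -EFinM lte_fin mulr_gt0//; lra.
apply: (@le_trans _ _ (\int[@lebesgue_measure R]_(y in K) (f y)%:E)%E).
  apply: ge0_le_integral => //.
  - by move=> y _; rewrite lee_fin; lra.
  - by apply/measurable_EFinP; exact: measurable_funS mf.
  - by move=> y /KD[_ /ltW]; rewrite lee_fin.
by apply: ge0_subset_integral => //; exact/measurable_EFinP.
Unshelve. all: by end_near. Qed.

(** * Fundamental theorem of calculus on a set exhausted by segments *)

Section exhaustion.
Variable R : realType.
Notation mu := (@lebesgue_measure R).
Variables (D : set R) (u v : R^nat) (f F : R -> R) (a b : R).
Hypothesis uv : forall n, u n < v n.
Hypothesis u_noninc : nonincreasing_seq u.
Hypothesis v_nondec : nondecreasing_seq v.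
Hypothesis DE : D = \bigcup_n `[u n, v n]%classic.
Hypothesis dF : forall x, D x -> is_derive x 1 F (f x).
Hypothesis cf : forall x, D x -> {for x, continuous f}.
Hypothesis Fu : F \o u @ \oo --> a.
Hypothesis Fv : F \o v @ \oo --> b.

Let segD n : `[u n, v n]%classic `<=` D.
Proof. by rewrite DE => x ?; exists n. Qed.

Let seg_nondec : nondecreasing_seq (fun n => `[u n, v n]%classic).
Proof.
move=> m n mn; apply/subsetPset => x /=; rewrite !in_itv/= => /andP[ux xv].
by rewrite (le_trans (u_noninc mn) ux) (le_trans xv (v_nondec mn)).
Qed.

Lemma exhaustion_measurable_fun : measurable D /\ measurable_fun D f.
Proof.
have mD : measurable D by rewrite DE; exact: bigcup_measurable.
split => //; rewrite DE.
apply/measurable_fun_bigcup => // n.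
apply: subspace_continuous_measurable_fun => //.
by apply: continuous_in_subspaceT => x /set_mem /segD; exact: cf.
Qed.

Let int_seg n : (\int[mu]_(x in `[u n, v n]) (f x)%:E = (F (v n) - F (u n))%:E)%E.
Proof.
have cF x : D x -> {for x, continuous F}.
  move=> /dF dFx; apply: differentiable_continuous; apply/derivable1_diffP.
  exact: ex_derive.
rewrite (@continuous_FTC2 _ f F) ?EFinB//.
- by apply: continuous_in_subspaceT => x /set_mem /segD; exact: cf.
- split.
  + move=> x /subset_itv_oo_cc xuv; apply: ex_derive; apply: dF.
    exact: (@segD n).
  + apply: cvg_at_right_filter; apply: cF; apply: (@segD n).
    by rewrite /= in_itv/= lexx ltW.
  + apply: cvg_at_left_filter; apply: cF; apply: (@segD n).
    by rewrite /= in_itv/= lexx ltW.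
- move=> x /subset_itv_oo_cc xuv; rewrite derive1E; apply: derive_val.
  by apply: dF; exact: (@segD n).
Qed.

Let cvg_seg : (\int[mu]_(x in `[u n, v n]) (f x)%:E)%E @[n --> \oo] --> (b - a)%:E.
Proof.
rewrite (_ : (fun _ => _) = fun n => (F (v n) - F (u n))%:E); last first.
  by apply/funext => n; exact: int_seg.
by apply: cvg_EFin; [exact: nearW | exact: cvgB].
Qed.

Let mf_seg n : measurable_fun `[u n, v n]%classic (fun x => (f x)%:E).
Proof.
have [mD mf] := exhaustion_measurable_fun.
by apply/measurable_EFinP; apply: measurable_funS mf => //; exact: segD.
Qed.

(** Monotone convergence along the segments. Finiteness of the integral is a conclusion here, so
    this is the tool that makes the majorants below integrable. *)
Lemma ge0_exhaustion_FTC : (forall x, D x -> 0 <= f x) ->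
  (\int[mu]_(x in D) (f x)%:E = (b - a)%:E)%E.
Proof.
move=> f0; apply: cvg_unique cvg_seg => //; rewrite DE.
apply: ge0_nondecreasing_set_cvg_integral => // n x /segD Dx.
by rewrite lee_fin f0.
Qed.

(** Monotone convergence for the positive and the negative part separately; integrability keeps the
    difference of the limits meaningful. *)
Lemma integrable_exhaustion_FTC : mu.-integrable D (EFin \o f) ->
  (\int[mu]_(x in D) (f x)%:E = (b - a)%:E)%E.
Proof.
move=> intf; apply: cvg_unique cvg_seg => //.
have -> : (fun n => \int[mu]_(x in `[u n, v n]) (f x)%:E)%E =
  (fun n => \int[mu]_(x in `[u n, v n]) (EFin \o f)^\+ x
          - \int[mu]_(x in `[u n, v n]) (EFin \o f)^\- x)%E.
  by apply/funext => n; rewrite integralE.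
rewrite [(\int[mu]_(x in D) _)%E]integralE.
have [mD mf] := exhaustion_measurable_fun.
apply: cvgeB.
- apply: fin_num_adde_defr; exact: integrable_pos_fin_num.
- rewrite DE.
  apply: ge0_nondecreasing_set_cvg_integral => //.
  by move=> n; apply: measurable_funepos; exact: mf_seg.
- rewrite DE.
  apply: ge0_nondecreasing_set_cvg_integral => //.
  by move=> n; apply: measurable_funeneg; exact: mf_seg.
Qed.

End exhaustion.

End integration_on_open_intervals.

(** * The Gamma function *)

Section Gamma_function.
Local Open Scope classical_set_scope.
Variable R : realType.
Notation mu := (@lebesgue_measure R).
Implicit Types (t z : R).

Let lo : R^nat := fun n => n.+1%:R^-1.
(** The offset 2 makes the segment nondegenerate already at n = 0, where its lower end is 1. *)
Let hi : R^nat := fun n => n.+2%:R.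

Let lo_hi n : lo n < hi n.
Proof.
by rewrite /lo /hi (@le_lt_trans _ _ 1)// ?invf_le1 ?ler1n ?ltr1n ?ltr0n.
Qed.

Let lo_noninc : nonincreasing_seq lo.
Proof. by move=> m n mn; rewrite lef_pV2 ?posrE ?ltr0n// ler_nat. Qed.

Let hi_nondec : nondecreasing_seq hi.
Proof. by move=> m n mn; rewrite ler_nat !ltnS. Qed.

Let itv0yE : `]0, +oo[%classic = \bigcup_n `[lo n, hi n]%classic :> set R.
Proof.
apply/seteqP; split => x /=; last first.
  move=> [n _] /=; rewrite !in_itv/= andbT => /andP[+ _]; apply: lt_le_trans.
  by rewrite invr_gt0 ltr0n.
rewrite in_itv/= andbT => x0.
pose n := Num.truncn (Num.max x x^-1).
have mx0 : 0 <= Num.max x x^-1 by rewrite le_max ltW.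
have := truncnS_gt (Num.max x x^-1); rewrite -/n gt_max => /andP[xn xVn].
exists n => //=; rewrite in_itv/= /lo /hi /=; apply/andP; split.
  by rewrite invf_ple ?posrE ?ltr0n// ltW.
by rewrite (le_trans (ltW xn))// ler_nat.
Qed.

Let cvg_lo (F : R -> R) (a : R) : F t @[t --> 0^'+] --> a -> F \o lo @ \oo --> a.
Proof.
move=> Fa; move/cvg_at_rightP : Fa; apply; split.
  by move=> n; rewrite invr_gt0 ltr0n.
by apply: cvg_harmonic.
Qed.

Let cvg_hi (F : R -> R) (a : R) : F t @[t --> +oo] --> a -> F \o hi @ \oo --> a.
Proof.
move=> /cvg_pinftyP; apply; apply/cvgryPge => A.
near=> n; rewrite (@le_trans _ _ n%:R)//.
  by near: n; exact: nbhs_infty_ger.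
by rewrite /hi ler_nat -addn2 leq_addr.
Unshelve. all: by end_near. Qed.

Lemma is_derive_powR z t : 0 < t -> is_derive t 1 (@powR R ^~ z) (z * t `^ (z - 1)).
Proof.
move=> t0; have t_in : t \in `]0, +oo[%R by rewrite in_itv/= t0.
apply: DeriveDef; first exact: derivable_powR.
by rewrite -derive1E powR_derive1.
Qed.

Lemma continuous_powR z t : 0 < t -> {for t, continuous (@powR R ^~ z)}.
Proof.
move=> /(@is_derive_powR z) dt; apply: differentiable_continuous.
by apply/derivable1_diffP; exact: ex_derive.
Qed.

(** This is ln y <= y - 1 at y = t / (2 z), multiplied by z. The 2 is chosen so that a factor
    e^(-t/2) survives multiplication by e^(-t). *)
Lemma powR_le_expR z t : 0 < z -> 0 < t ->
  t `^ z <= expR (z * ln (2 * z) - z) * expR (t / 2).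
Proof.
move=> z0 t0; rewrite /powR gt_eqF// -expRD ler_expR.
have := @le_ln1Dx R (t / (2 * z) - 1).
rewrite [1 + _]addrC subrK ltrBrDl subrr divr_gt0 ?mulr_gt0//.
move=> /(_ isT); rewrite lnM ?posrE ?invr_gt0 ?mulr_gt0// lnV ?posrE ?mulr_gt0//.
move=> H; have := ler_wpM2l (ltW z0) H.
rewrite !mulrBr !mulr1 (_ : z * (t / (2 * z)) = t / 2); last first.
  by field; rewrite gt_eqF.
lra.
Qed.

Let kern z t := t `^ (z - 1) * expR (- t).

(** The boundary term t^z e^(-t) of the integration by parts that gives the functional equation. *)
Let is_derive_parts z t : 0 < t ->
  is_derive t 1 (fun t => t `^ z * expR (- t)) (z * kern z t - kern (z + 1) t).
Proof.
move=> t0; have dp := is_derive_powR z t0.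
have de : is_derive t 1 (fun t => expR (- t)) (- expR (- t)).
  by apply: is_derive_eq; rewrite /GRing.scale/= mulrN1.
apply: (is_derive_eq (is_deriveM dp de)).
rewrite /kern addrK /GRing.scale/=; ring.
Qed.

Let continuous_kern z t : 0 < t -> {for t, continuous (kern z)}.
Proof.
move=> t0; apply: cvgM; first exact: continuous_powR.
apply: continuous_comp; last exact: continuous_expR.
exact: opp_continuous.
Qed.

Let expR_half_cvg : expR (- (t / 2)) @[t --> +oo] --> (0 : R).
Proof.
apply: (@cvg_comp _ _ _ (fun t => t / 2) (fun t => expR (- t)) _ _ _ _ (@cvgr_expR R)).
by apply: gt0_cvgMly; [rewrite invr_gt0 | exact: cvg_id].
Qed.

Let parts_cvg0 z : 0 < z -> (fun t => t `^ z * expR (- t)) t @[t --> 0^'+] --> (0 : R).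
Proof.
move=> z0.
apply: (@squeeze_cvgr _ _ _ _ (fun=> 0) (fun t => t `^ z)).
- near=> t; have t0 : 0 < t by [].
  rewrite mulr_ge0 ?powR_ge0 ?expR_ge0//= ler_piMr ?powR_ge0//.
  by rewrite -expR0 ler_expR oppr_le0 ltW.
- exact: cvg_cst.
- exact: powR_cvg0.
Unshelve. all: by end_near. Qed.

Let parts_le z t : 0 < z -> 0 < t ->
  t `^ z * expR (- t) <= expR (z * ln (2 * z) - z) * expR (- (t / 2)).
Proof.
move=> z0 t0; apply: le_trans (ler_wpM2r (expR_ge0 _) (powR_le_expR z0 t0)) _.
by rewrite -mulrA -[expR (t / 2) * _]expRD (_ : t / 2 + - t = - (t / 2)) //; field.
Qed.

Let parts_cvgy z : 0 < z -> (fun t => t `^ z * expR (- t)) t @[t --> +oo] --> (0 : R).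
Proof.
move=> z0.
apply: (@squeeze_cvgr _ _ _ _ (fun=> 0)
         (fun t => expR (z * ln (2 * z) - z) * expR (- (t / 2)))).
- near=> t; have t0 : 0 < t by [].
  by rewrite mulr_ge0 ?powR_ge0 ?expR_ge0//= parts_le.
- exact: cvg_cst.
- by rewrite -[X in _ --> X](mulr0 (expR (z * ln (2 * z) - z))); apply: cvgMr; exact: expR_half_cvg.
Unshelve. all: by end_near. Qed.

(** The majorant [g] is built as a derivative. Dividing the derivative of t^z e^(-t) by z gives the
    integrand minus t^z e^(-t) / z, and adding (c / z) e^(-t/2) outweighs the subtracted term by
    [parts_le]. The primitive [G] has finite limits at 0 and at infinity. *)
Lemma integrable_Gamma z : 0 < z ->
  mu.-integrable `]0, +oo[ (fun t => (t `^ (z - 1) * expR (- t))%:E).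
Proof.
move=> z0; pose c := expR (z * ln (2 * z) - z).
pose G t := z^-1 * (t `^ z * expR (- t)) - 2 * c / z * expR (- (t / 2)).
pose g t := z^-1 * (z * kern z t - kern (z + 1) t) + c / z * expR (- (t / 2)).
have de t : is_derive t 1 (fun t => expR (- (t / 2))) (- (expR (- (t / 2)) / 2)).
  apply: is_derive_eq; rewrite /GRing.scale/=; ring.
have ce t : {for t, continuous (fun t => expR (- (t / 2)))}.
  apply: differentiable_continuous; apply/derivable1_diffP.
  exact: (@ex_derive _ _ _ _ _ _ _ (de t)).
have dG t : 0 < t -> is_derive t 1 G (g t).
  move=> t0; have d1 := @is_derive_parts z t t0.
  apply: (is_derive_eq (is_deriveB (is_deriveZ z^-1 d1) (is_deriveZ (2 * c / z) (de t)))).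
  rewrite /g /GRing.scale/=; field.
  by rewrite gt_eqF.
have cg t : 0 < t -> {for t, continuous g}.
  move=> t0; apply: cvgD; apply: cvgMr.
    by apply: cvgB; [apply: cvgMr|]; exact: continuous_kern.
  exact: ce.
have gk t : 0 < t -> kern z t <= g t.
  move=> t0; rewrite /g mulrBr mulrA mulVf ?gt_eqF// mul1r -addrA lerDl.
  rewrite [c / z]mulrC -mulrA addrC -mulrBr mulr_ge0 ?invr_ge0 ?(ltW z0)//.
  rewrite subr_ge0 /kern addrK; exact: parts_le.
have k0 t : 0 <= kern z t by rewrite mulr_ge0 ?powR_ge0 ?expR_ge0.
have g0 t : 0 < t -> 0 <= g t by move=> /gk; exact: le_trans.
have G0 : G t @[t --> 0^'+] --> - (2 * c / z).
  rewrite -[X in _ --> X]sub0r -[X in X - _](mulr0 z^-1) -[2 * c / z in X in _ --> X]mulr1.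
  apply: cvgB; apply: cvgMr; first exact: parts_cvg0.
  apply: cvg_at_right_filter.
  rewrite [X in _ --> X](_ : _ = expR (- (0 / 2))); last by rewrite mul0r oppr0 expR0.
  exact: ce.
have Gy : G t @[t --> +oo] --> (0 : R).
  rewrite -[X in _ --> X](subrr 0) -[X in X - _](mulr0 z^-1) -[X in _ - X](mulr0 (2 * c / z)).
  by apply: cvgB; apply: cvgMr; [exact: parts_cvgy | exact: expR_half_cvg].
have in0y t : `]0, +oo[%classic t -> 0 < t by rewrite /= in_itv/= andbT.
have intg := ge0_exhaustion_FTC lo_hi lo_noninc hi_nondec itv0yE
  (fun t Dt => dG t (in0y t Dt)) (fun t Dt => cg t (in0y t Dt))
  (cvg_lo G0) (cvg_hi Gy) (fun t Dt => g0 t (in0y t Dt)).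
have [mD mg] := exhaustion_measurable_fun itv0yE
  (fun t Dt => cg t (in0y t Dt)).
have [_ mk] := exhaustion_measurable_fun itv0yE
  (fun t Dt => @continuous_kern z t (in0y t Dt)).
apply: (@le_integrable _ _ _ mu _ mD _ (fun t => (g t)%:E)) => //.
- exact/measurable_EFinP.
- move=> t /in0y t0 /=; rewrite lee_fin !ger0_norm; [exact: gk|exact: g0|exact: k0].
- apply/integrableP; split; first exact/measurable_EFinP.
  under eq_integral => t /set_mem /in0y t0.
    rewrite /= ger0_norm; last exact: g0.
    over.
  by rewrite intg ltry.
Qed.

(** The boundary term t^z e^(-t) tends to 0 at both ends, so the integral of its derivative is 0. *)
Lemma GammaS z : 0 < z -> Gamma (z + 1) = z * Gamma z.
Proof.
move=> z0.
have z10 : 0 < z + 1 by rewrite addr_gt0.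
have in0y t : `]0, +oo[%classic t -> 0 < t by rewrite /= in_itv/= andbT.
have ik := integrable_Gamma z0; have ikS := integrable_Gamma z10.
have izk : mu.-integrable `]0, +oo[ (EFin \o (fun t => z * kern z t)).
  rewrite (_ : _ \o _ = fun t => z%:E * (kern z t)%:E)%E; last exact/funext.
  exact: integrableZl.
have intf : mu.-integrable `]0, +oo[
    (EFin \o (fun t => z * kern z t - kern (z + 1) t)).
  rewrite (_ : _ \o _ = (fun t => (z * kern z t)%:E - (kern (z + 1) t)%:E)%E); last exact/funext.
  exact: integrableB.
have cf t : 0 < t -> {for t, continuous (fun t => z * kern z t - kern (z + 1) t)}.
  move=> t0; apply: cvgB; last exact: continuous_kern.
  by apply: cvgMr; exact: continuous_kern.
have := integrable_exhaustion_FTC lo_hi lo_noninc hi_nondec itv0yE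
  (fun t Dt => @is_derive_parts z t (in0y t Dt)) (fun t Dt => cf t (in0y t Dt))
  (cvg_lo (parts_cvg0 z0)) (cvg_hi (parts_cvgy z0)) intf.
move=> /(congr1 fine) /=; rewrite subrr -/(Rintegral _ _ _).
rewrite RintegralB// RintegralZl// => /eqP; rewrite subr_eq0 => /eqP ->.
by apply: eq_Rintegral => t _; rewrite /kern.
Qed.

Lemma Gamma_gt0 z : 0 < z -> 0 < Gamma z.
Proof.
move=> z0; have /integrableP[mk _] := integrable_Gamma z0.
have fk := integrable_fin_num _ (integrable_Gamma z0).
rewrite -lte_fin /Gamma /Rintegral fineK; last exact: fk.
have D1 : nbhs (1 : R) `]0, +oo[%classic.
  by apply: open_nbhs_nbhs; split; [exact: interval_open | rewrite /= in_itv/= ltr01].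
apply: (integral_gt0_near _ _ D1) => //.
- exact/measurable_EFinP.
- exact: continuous_kern.
- by move=> t _; rewrite mulr_ge0 ?powR_ge0 ?expR_ge0.
Qed.

End Gamma_function.

(** * The scalar Gegenbauer functional *)

(* [gweight nu x * (pearson nu p).[x]] is the derivative of [(1 - x^2)^(nu + 1/2) * p.[x]]. *)
Definition pearson (R : realType) (nu : R) (p : {poly R}) : {poly R} :=
  (1 - 'X^2) * p^`() - (2 * nu + 1) *: ('X * p).

Definition gweight (R : realType) (nu x : R) : R := (1 - x ^+ 2) `^ (nu - 2^-1).

Definition gint (R : realType) (nu : R) (p : {poly R}) : R :=
  \int[@lebesgue_measure R]_(x in `]-1, 1[) (gweight nu x * p.[x]).

Section gegenbauer_functional.
Local Open Scope classical_set_scope.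
Variables (R : realType) (nu : R).
Hypothesis nu_gt0 : 0 < nu.
Notation mu := (@lebesgue_measure R).
Implicit Types (p q : {poly R}) (x : R).

Let D : set R := `]-1, 1[%classic.
Let hi : R^nat := fun n => 1 - n.+2%:R^-1.
Let lo : R^nat := fun n => - hi n.

Let hi_bnd n : 0 < hi n < 1.
Proof.
rewrite /hi subr_gt0 invf_lt1 ?ltr0n// ltr1n /= gtrBl invr_gt0.
by rewrite ltr0n.
Qed.

Let lo_hi n : lo n < hi n.
Proof. by have /andP[h0 _] := hi_bnd n; rewrite /lo; lra. Qed.

Let hi_nondec : nondecreasing_seq hi.
Proof.
by move=> m n mn; rewrite lerD2l lerN2 lef_pV2 ?posrE ?ltr0n// ler_nat !ltnS.
Qed.

Let lo_noninc : nonincreasing_seq lo.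
Proof. by move=> m n mn; rewrite /lo lerN2 hi_nondec. Qed.

Let in_D x : D x = (-1 < x < 1) :> Prop.
Proof. by rewrite /D /= in_itv. Qed.

Let DE : D = \bigcup_n `[lo n, hi n]%classic.
Proof.
apply/seteqP; split => x; last first.
  move=> [n _] /=; rewrite !in_itv/= => /andP[xl xh].
  have /andP[h0 h1] := hi_bnd n.
  by rewrite in_D (le_lt_trans xh)// andbT (lt_le_trans _ xl)// /lo ltrN2.
rewrite in_D -ltr_norml => x1; pose n := Num.truncn (1 - `|x|)^-1.
have /ltW xn := truncnS_gt (1 - `|x|)^-1.
have x10 : 0 < 1 - `|x| by rewrite subr_gt0.
exists n => //=; rewrite in_itv/= /lo -ler_norml /hi lerBrDl -lerBrDr.
rewrite invf_ple ?posrE ?ltr0n//; apply: le_trans xn _.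
by rewrite ler_nat.
Qed.

Let cvg_hi : hi @ \oo --> (1 : R).
Proof.
rewrite -[X in _ --> X]subr0; apply: cvgB; first exact: cvg_cst.
by have := @cvg_harmonic R; rewrite -(@cvg_shiftn 1) /=; under eq_fun do rewrite addn1.
Qed.

Let cvg_lo : lo @ \oo --> (-1 : R).
Proof. by apply: cvgN; exact: cvg_hi. Qed.

Let om : {poly R} := 1 - 'X^2.

Let omE x : om.[x] = 1 - x ^+ 2.
Proof. by rewrite !hornerE. Qed.

Let om_gt0 x : D x -> 0 < om.[x].
Proof. by rewrite in_D omE => /andP[x1 x2]; nra. Qed.

Let gweightE x : gweight nu x = om.[x] `^ (nu - 2^-1).
Proof. by rewrite omE. Qed.

Let nu2 : 0 < nu + 2^-1. Proof. by rewrite addr_gt0. Qed.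

Let omegaS x : D x -> om.[x] `^ (nu + 2^-1) = om.[x] * gweight nu x.
Proof.
move=> /om_gt0 om0; rewrite gweightE -{2}[om.[x]]powRr1 ?ltW// -powRD.
  by congr powR; field.
by apply/implyP => _; rewrite gt_eqF.
Qed.

Let prim p x := om.[x] `^ (nu + 2^-1) * p.[x].

Let is_derive_prim p x : D x ->
  is_derive x 1 (prim p) (gweight nu x * (pearson nu p).[x]).
Proof.
move=> Dx; have om0 := om_gt0 Dx.
have d1 := is_derive1_comp (is_derive_powR (nu + 2^-1) om0) (is_derive_poly om x).
apply: (is_derive_eq (is_deriveM d1 (is_derive_poly p x))).
rewrite /= omegaS// (_ : nu + 2^-1 - 1 = nu - 2^-1); last by field.
rewrite -gweightE /pearson /GRing.scale/= /om derivB derivXn derivC !hornerE/=.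
by field.
Qed.

Let continuous_gweight p x : D x -> {for x, continuous (fun x => gweight nu x * p.[x])}.
Proof.
move=> Dx; suff cw : {for x, continuous (gweight nu)}.
  by apply: cvgM; [exact: cw | exact: continuous_horner].
have -> : gweight nu = (fun y => y `^ (nu - 2^-1)) \o horner om.
  by apply/funext => y; rewrite gweightE.
apply: continuous_comp; first exact: continuous_horner.
exact: (continuous_powR (om_gt0 Dx)).
Qed.

Let prim_cvg p (u : R^nat) (a : R) : a ^+ 2 = 1 -> (forall n, D (u n)) ->
  u @ \oo --> a -> prim p \o u @ \oo --> (0 : R).
Proof.
move=> a2 Du ua; rewrite -[X in _ --> X](mul0r p.[a]); apply: cvgM; last first.
  by apply: (cvg_comp u (horner p) ua); exact: continuous_horner.
have /cvg_at_rightP := powR_cvg0 nu2.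
apply; split; first by move=> n; exact: om_gt0.
rewrite (_ : 0 = om.[a]); last by rewrite omE a2 subrr.
by apply: (cvg_comp u (horner om) ua); exact: continuous_horner.
Qed.

Let Dhi n : D (hi n).
Proof. by rewrite in_D; have := hi_bnd n; lra. Qed.

Let Dlo n : D (lo n).
Proof. by rewrite in_D /lo; have := hi_bnd n; lra. Qed.

Let primhi p : prim p \o hi @ \oo --> (0 : R).
Proof. by apply: prim_cvg cvg_hi => //; rewrite expr1n. Qed.

Let primlo p : prim p \o lo @ \oo --> (0 : R).
Proof. by apply: prim_cvg cvg_lo => //; rewrite sqrrN expr1n. Qed.

Let measurable_gweight p : measurable D /\ measurable_fun D (fun x => gweight nu x * p.[x]).
Proof. by apply: (exhaustion_measurable_fun DE); exact: continuous_gweight. Qed.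

Let gweight_ge0 x : 0 <= gweight nu x. Proof. exact: powR_ge0. Qed.

(** For nu < 1/2 the weight is unbounded at the endpoints, so it is dominated by a derivative. The
    polynomial [pearson nu (- 'X)] equals (2 nu + 1) - (2 nu + 2)(1 - x^2), and (1 - x^2) times the
    weight is at most 1; adding c = 2 nu + 2 therefore yields at least the weight. *)
Let integrable_gweight1 : mu.-integrable D (EFin \o gweight nu).
Proof.
pose c := 2 * nu + 2.
pose g x := gweight nu x * (pearson nu (- 'X)).[x] + c.
pose G x := prim (- 'X) x + c * x.
have dG x : D x -> is_derive x 1 G (g x).
  move=> Dx; have d1 := is_derive_prim (- 'X) Dx.
  apply: (is_derive_eq (is_deriveD d1 (is_deriveZ c (is_derive_id x 1)))).
  by rewrite /g /GRing.scale/= mulr1.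
have cg x : D x -> {for x, continuous g}.
  by move=> Dx; apply: cvgD; [exact: continuous_gweight | exact: cvg_cst].
have wg x : D x -> gweight nu x <= g x.
  move=> Dx; have om0 := om_gt0 Dx.
  have w1 : om.[x] * gweight nu x <= 1.
    rewrite -omegaS// (@le_trans _ _ (1 `^ (nu + 2^-1)))//; last by rewrite powR1.
    by rewrite ge0_ler_powR ?nnegrE ?(ltW nu2) ?(ltW om0)// omE gerBl sqr_ge0.
  have w0 := gweight_ge0 x.
  rewrite /g (_ : (pearson nu (- 'X)).[x] = (2 * nu + 1) - (2 * nu + 2) * om.[x]).
    have h1 : 0 <= nu * gweight nu x by rewrite mulr_ge0 ?(ltW nu_gt0).
    have h2 : 0 <= nu * (1 - om.[x] * gweight nu x) by rewrite mulr_ge0 ?subr_ge0 ?(ltW nu_gt0).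
    by rewrite /c; lra.
  rewrite omE /pearson derivN derivX !hornerE/=; ring.
have g0 x : D x -> 0 <= g x by move=> /wg; exact: le_trans.
have Glo : G \o lo @ \oo --> 0 + c * (- 1).
  by apply: cvgD; [exact: primlo | apply: cvgMr].
have Ghi : G \o hi @ \oo --> 0 + c * 1.
  by apply: cvgD; [exact: primhi | apply: cvgMr].
have intg := ge0_exhaustion_FTC lo_hi lo_noninc hi_nondec DE dG cg Glo Ghi g0.
have [mD mg] := exhaustion_measurable_fun DE cg.
have [_ mw] := measurable_gweight 1.
apply: (@le_integrable _ _ _ mu _ mD _ (fun x => (g x)%:E)).
- apply/measurable_EFinP; apply: eq_measurable_fun mw => x _.
  by rewrite hornerC mulr1.
- by move=> x Dx; rewrite lee_fin !ger0_norm//; [exact: wg|exact: g0].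
- apply/integrableP; split; first exact/measurable_EFinP.
  under eq_integral => x /set_mem Dx.
    rewrite /= ger0_norm; last exact: g0.
    over.
  by rewrite intg ltry.
Qed.

Lemma integrable_gweight p : mu.-integrable D (EFin \o (fun x => gweight nu x * p.[x])).
Proof.
have [mD mw] := measurable_gweight p.
pose C := \sum_(i < size p) `|p`_i|.
apply: (@le_integrable _ _ _ mu _ mD _ (fun x => (C * gweight nu x)%:E)).
- exact/measurable_EFinP.
- move=> x; rewrite in_D -ltr_norml => /ltW x1.
  rewrite lee_fin normrM mulrC [leRHS]normrM [`|gweight _ _|]ger0_norm// ler_wpM2r//.
  rewrite horner_coef; apply: le_trans (ler_norm_sum _ _ _) _.
  rewrite (le_trans _ (ler_norm _))//.
  apply: ler_sum => i _; rewrite normrM normrX ler_piMr//.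
  by rewrite exprn_ile1.
- rewrite (_ : (fun _ => _) = fun x => C%:E * (gweight nu x)%:E)%E; last exact/funext.
  by apply: integrableZl => //; exact: integrable_gweight1.
Qed.

(** The primitive (1 - x^2)^(nu + 1/2) p vanishes at both endpoints because its exponent is
    positive. *)
Lemma gint_pearson p : gint nu (pearson nu p) = 0.
Proof.
have := integrable_exhaustion_FTC lo_hi lo_noninc hi_nondec DE
  (@is_derive_prim p) (@continuous_gweight (pearson nu p)) (primlo p) (primhi p)
  (integrable_gweight (pearson nu p)).
by move=> /(congr1 fine) /=; rewrite subrr.
Qed.

Lemma gintD p q : gint nu (p + q) = gint nu p + gint nu q.
Proof.
have [mD _] := measurable_gweight 1.
rewrite /gint -RintegralD//; try exact: integrable_gweight.
by apply: eq_Rintegral => x _; rewrite hornerD mulrDr.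
Qed.

Lemma gintZ (c : R) p : gint nu (c *: p) = c * gint nu p.
Proof.
have [mD _] := measurable_gweight 1.
rewrite /gint -RintegralZl//; last exact: integrable_gweight.
by apply: eq_Rintegral => x _; rewrite hornerZ mulrCA.
Qed.

Lemma gint_sqr_eq0 p : gint nu (p ^+ 2) = 0 -> p = 0.
Proof.
move=> Ip0; apply/eqP/negPn/negP => p0.
have [x Dx px] : exists2 x, D x & p.[x] != 0.
  (* These are [size p] distinct points of the interval, more than p has roots. *)
  pose s := [seq (k.+2%:R : R)^-1 | k <- iota 0 (size p)].
  have us : uniq s.
    rewrite map_inj_uniq ?iota_uniq// => i j /invr_inj/eqP.
    by rewrite eqr_nat !eqSS => /eqP.
  have : ~~ all (root p) s.
    apply/negP => /(max_poly_roots p0)/(_ us).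
    by rewrite size_map size_iota ltnn.
  move=> /allPn[_ /mapP[k _ ->] rk]; exists k.+2%:R^-1 => //.
  rewrite in_D; apply/andP; split; last by rewrite invf_lt1 ?ltr0n// ltr1n.
  by rewrite (@lt_trans _ _ 0)// invr_gt0 ltr0n.
have [mD mw] := measurable_gweight (p ^+ 2).
have nD : nbhs x D.
  by apply: open_nbhs_nbhs; split => //; exact: interval_open.
have := integral_gt0_near mD mw nD (@continuous_gweight (p ^+ 2) x Dx).
rewrite -[X in (_ < X)%E]fineK; last first.
  by apply: integrable_fin_num => //; exact: integrable_gweight.
rewrite -/(Rintegral _ _ _) -/(gint _ _) Ip0 ltxx => absurd; suff: false by [].
apply: absurd; first by move=> y _; rewrite mulr_ge0// horner_exp sqr_ge0.
rewrite mulr_gt0 ?gweightE ?powR_gt0 ?om_gt0//.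
by rewrite horner_exp exprn_even_gt0.
Qed.

End gegenbauer_functional.

(** * Scalar Gegenbauer polynomials *)

Section gegenbauer_polynomials.
Variables (R : realType) (nu : R).

Lemma pochS (a : R) k : poch a k.+1 = poch a k * (a + k%:R).
Proof. by rewrite /poch big_ord_recr. Qed.

Lemma poch_gt0 (a : R) k : 0 < a -> 0 < poch a k.
Proof. by move=> a0; apply: prodr_gt0 => i _; rewrite ltr_wpDr. Qed.

Lemma Gamma_poch (z : R) k : 0 < z -> Gamma (z + k%:R) = poch z k * Gamma z.
Proof.
move=> z0; elim: k => [|k IH]; first by rewrite addr0 /poch big_ord0 mul1r.
have zk : 0 < z + k%:R by rewrite ltr_wpDr.
by rewrite -natr1 addrA (GammaS zk) IH pochS mulrA [_ * poch _ _]mulrC.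
Qed.

(** The coefficient of x^j in C_(j + 2 s). The indexing by j and s turns shifts of the degree into
    shifts of s, free of truncated subtraction. *)
Definition gegen_coef j s : R := (-1) ^+ s * poch nu (j + s) * 2 ^+ j / (s`! * j`!)%:R.

Definition gegen n : {poly R} :=
  \sum_(k < n./2.+1) gegen_coef (n - 2 * k) k *: 'X^(n - 2 * k).

Lemma coef_gegen j s : (gegen (j + s.*2))`_j = gegen_coef j s.
Proof.
have sP : (s < (j + s.*2)./2.+1)%N by lia.
rewrite coef_sum (bigD1 (Ordinal sP))//= big1 ?addr0 => [|i /eqP ni].
  have -> : (j + s.*2 - 2 * s = j)%N by lia.
  by rewrite coefZ coefXn eqxx mulr1.
rewrite coefZ coefXn; case: eqP => [ji|_]; last by rewrite mulr0.
by case: ni; apply/val_inj => /=; have := ltn_ord i; lia.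
Qed.

Lemma coef_gegen_eq0 n j : (forall s, n != j + s.*2)%N -> (gegen n)`_j = 0.
Proof.
move=> nj; rewrite coef_sum big1// => i _; rewrite coefZ coefXn.
case: eqP => [ji|_]; last by rewrite mulr0.
have := nj i; have := ltn_ord i; lia.
Qed.

Lemma gegenP n j :
  (exists2 s, n = (j + s.*2)%N & (gegen n)`_j = gegen_coef j s) \/
  (forall s, n != j + s.*2)%N /\ (gegen n)`_j = 0.
Proof.
have [/andP[jn ev]|nP] := boolP ((j <= n)%N && ~~ odd (n - j)).
  have E : n = (j + ((n - j)./2).*2)%N by lia.
  by left; exists (n - j)./2 => //; rewrite [in LHS]E coef_gegen.
have nj s : (n != j + s.*2)%N by apply/negP => /eqP ns; move: nP; lia.
by right; split => //; exact: coef_gegen_eq0.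
Qed.

Lemma fact_neq0 n : (n`!%:R : R) != 0.
Proof. by rewrite pnatr_eq0 -lt0n fact_gt0. Qed.

Lemma natS_neq0 n : (1 + n%:R : R) != 0.
Proof. by rewrite nat1r pnatr_eq0. Qed.

Lemma gegen_coefS j s : j.+1%:R * gegen_coef j.+1 s = 2 * (nu + (j + s)%:R) * gegen_coef j s.
Proof.
rewrite /gegen_coef addSn pochS exprS factS !natrM.
by field; rewrite !fact_neq0 natS_neq0.
Qed.

Lemma gegen_coefSr j s :
  s.+1%:R * gegen_coef j s.+1 = - (nu + (j + s)%:R) * gegen_coef j s.
Proof.
rewrite /gegen_coef addnS pochS exprS factS !natrM.
by field; rewrite !fact_neq0 natS_neq0.
Qed.

(** This and [gegen_XderivS] are read off from the coefficients. The later identities follow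
    formally from these two; only the three-term recurrence also needs a look at its constant
    term. *)
Lemma gegen_derivS n :
  (gegen n.+1)^`() = (n%:R + 2 * nu)%:P * gegen n + 'X * (gegen n)^`().
Proof.
apply/polyP => j; rewrite coef_deriv coefD coefCM coefXM coef_deriv.
have -> : (if j == 0%N then 0 else (gegen n)`_j.-1.+1 *+ j.-1.+1) = (gegen n)`_j *+ j.
  by case: j.
case: (gegenP n j) => [[s nE ->]|[nj ->]].
  rewrite nE -addSn coef_gegen -[LHS]mulr_natl gegen_coefS -mulr_natl -addnn !natrD.
  ring.
by rewrite coef_gegen_eq0 => [|s]; rewrite ?mul0rn ?mulr0 ?addr0// addSn eqSS.
Qed.

Lemma gegen_XderivS n :
  'X * (gegen n.+1)^`() = n.+1%:R%:P * gegen n.+1 + (gegen n)^`().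
Proof.
apply/polyP => j; rewrite coefXM coefD coefCM !coef_deriv.
have -> : (if j == 0%N then 0 else (gegen n.+1)`_j.-1.+1 *+ j.-1.+1) = (gegen n.+1)`_j *+ j.
  by case: j.
case: (gegenP n.+1 j) => [[[|s] nE ->]|[nj ->]].
- rewrite coef_gegen_eq0 => [|s]; last by lia.
  by rewrite mul0rn addr0 nE addn0 mulr_natl.
- have -> : n = (j.+1 + s.*2)%N by lia.
  have H1 := gegen_coefS j s; have H2 := gegen_coefSr j s.
  have -> : ((j.+1 + s.*2).+1 = j + s.+1 + s.+1)%N by lia.
  rewrite coef_gegen -[in RHS](mulr_natl _ j.+1) H1 -mulr_natl natrD.
  have -> : 2 * (nu + (j + s)%:R) * gegen_coef j s = - 2 * (s.+1%:R * gegen_coef j s.+1).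
    by rewrite H2; ring.
  ring.
- rewrite coef_gegen_eq0 => [|s]; last by have := nj s.+1; lia.
  by rewrite !mul0rn mulr0 addr0.
Qed.

Lemma poly_deriv_eq (p q : {poly R}) : p^`() = q^`() -> p`_0 = q`_0 -> p = q.
Proof.
move=> dpq pq0; apply/polyP => -[//|j].
have /(congr1 (fun r : {poly R} => r`_j)) := dpq; rewrite !coef_deriv.
by move/eqP; rewrite eqrMn2r// => /eqP.
Qed.

(** The value 0 in negative degrees keeps the identities valid for every integer m, so that sums can
    be shifted freely. *)
Definition gegenz (m : int) : {poly R} := if m is Posz n then gegen n else 0.

Lemma gegen0 : gegen 0 = 1.
Proof.
rewrite /gegen big_ord_recl big_ord0 addr0 /gegen_coef /poch !big_ord0 /=.
by rewrite !expr0 !mulr1 mul1r muln1 invr1 scale1r.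
Qed.

Lemma gegenz_deriv1 (m : int) :
  (gegenz (m + 1))^`() = (m%:~R + 2 * nu)%:P * gegenz m + 'X * (gegenz m)^`().
Proof.
case: m => [n|[|n]]; last 2 first.
- by rewrite (_ : Negz 0 + 1 = 0)//= gegen0 -polyC1 derivC deriv0 !mulr0 addr0.
- rewrite (_ : Negz n.+1 + 1 = Negz n) ?NegzE; last by lia.
  by rewrite /= !deriv0 !mulr0 addr0.
by rewrite (_ : Posz n + 1 = n.+1)/= ?gegen_derivS// -addn1 PoszD.
Qed.

Lemma gegenz_Xderiv (m : int) :
  'X * (gegenz m)^`() = m%:~R%:P * gegenz m + (gegenz (m - 1))^`().
Proof.
case: m => [[|n]|n]; last 1 first.
- rewrite (_ : Negz n - 1 = Negz n.+1) ?NegzE; last by lia.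
  by rewrite /= !deriv0 !mulr0 addr0.
- by rewrite /= gegen0 -polyC1 derivC deriv0 mul0r mulr0 addr0.
by rewrite (_ : Posz n.+1 - 1 = n)/= ?gegen_XderivS// -addn1 PoszD addrK.
Qed.

Lemma gegenz_deriv_diff (m : int) :
  (2 * (m%:~R + nu))%:P * gegenz m = (gegenz (m + 1))^`() - (gegenz (m - 1))^`().
Proof.
have h1 := gegenz_deriv1 m; have h2 := gegenz_Xderiv m.
have -> : (gegenz (m - 1))^`() = 'X * (gegenz m)^`() - m%:~R%:P * gegenz m.
  by rewrite h2; ring.
by rewrite h1; ring.
Qed.

Lemma gegenz_Xderiv_sum (m : int) :
  (2 * (m%:~R + nu))%:P * ('X * (gegenz m)^`()) =
  m%:~R%:P * (gegenz (m + 1))^`() + (m%:~R + 2 * nu)%:P * (gegenz (m - 1))^`().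
Proof.
have h1 := gegenz_deriv1 m; have h2 := gegenz_Xderiv m.
have -> : (gegenz (m - 1))^`() = 'X * (gegenz m)^`() - m%:~R%:P * gegenz m.
  by rewrite h2; ring.
by rewrite h1; ring.
Qed.

(** The derivatives of the two sides agree by the identities above, which leaves the constant
    terms. *)
Lemma gegenz_rec (m : int) :
  (2 * (m%:~R + nu))%:P * ('X * gegenz m) =
  (m%:~R + 1)%:P * gegenz (m + 1) + (m%:~R + 2 * nu - 1)%:P * gegenz (m - 1).
Proof.
apply: poly_deriv_eq.
  rewrite !(derivD, derivM, derivC, derivX, mul0r, add0r, mul1r).
  have h1 := gegenz_deriv1 m; have h2 := gegenz_Xderiv m.
  have -> : (gegenz (m - 1))^`() = 'X * (gegenz m)^`() - m%:~R%:P * gegenz m.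
    by rewrite h2; ring.
  by rewrite h1; ring.
rewrite !(coefD, coefCM, coefXM) eqxx mulr0.
case: m => [[|n]|[|n]].
- have -> : gegenz (Posz 0 + 1) = gegen 1 by [].
  have -> : gegenz (Posz 0 - 1) = 0 by [].
  rewrite coef_gegen_eq0 ?coef0 => [|s]; last by lia.
  by rewrite !mulr0 addr0.
- have -> : gegenz (Posz n.+1 + 1) = gegen n.+2 by rewrite -addn1 -PoszD addn1.
  have -> : gegenz (Posz n.+1 - 1) = gegen n by rewrite -addn1 PoszD addrK.
  case: (gegenP n.+2 0) => [[[|s] nE ->]|[nj ->]]; first by lia.
    have nE2 : n = (0 + s.*2)%N by lia.
    have -> : gegen n = gegen (0 + s.*2) by rewrite nE2.
    rewrite coef_gegen (_ : n.+1%:~R = s%:R + s%:R + 1); last first.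
      by rewrite -pmulrn -natr1 nE2 add0n -addnn natrD.
    have := gegen_coefSr 0 s; rewrite -natr1 add0n; lra.
  rewrite coef_gegen_eq0 => [|s]; last by have := nj s.+1; lia.
  by rewrite !mulr0 addr0.
(* At m = -1 the polynomial C_0 does occur, but its factor m + 1 is 0. *)
- have -> : gegenz (Negz 0 + 1) = gegen 0 by [].
  have -> : gegenz (Negz 0 - 1) = 0 by [].
  rewrite gegen0 coef1 coef0 NegzE; ring.
- have -> : gegenz (Negz n.+1 + 1) = 0 by rewrite (_ : _ + 1 = Negz n) ?NegzE; [|lia].
  have -> : gegenz (Negz n.+1 - 1) = 0 by rewrite (_ : _ - 1 = Negz n.+2) ?NegzE; [|lia].
  by rewrite coef0 !mulr0 addr0.
Qed.

Lemma gegenz_derivM (m : int) :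
  (1 - 'X^2) * (gegenz m)^`() =
  (m%:~R + 2 * nu)%:P * ('X * gegenz m) - (m%:~R + 1)%:P * gegenz (m + 1).
Proof.
have h1 := gegenz_deriv1 m; have := gegenz_Xderiv (m + 1).
rewrite addrK h1 => h2.
have -> : (1 - 'X^2) * (gegenz m)^`() = (gegenz m)^`() - 'X * ('X * (gegenz m)^`()) by ring.
have -> : 'X * ('X * (gegenz m)^`()) = (m + 1)%:~R%:P * gegenz (m + 1) + (gegenz m)^`()
   - (m%:~R + 2 * nu)%:P * ('X * gegenz m) by rewrite -h2; ring.
ring.
Qed.

Lemma gegenz_deriv (m : int) :
  (2 * (m%:~R + nu))%:P * ((1 - 'X^2) * (gegenz m)^`()) =
  ((m%:~R + 2 * nu) * (m%:~R + 2 * nu - 1))%:P * gegenz (m - 1)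
  - (m%:~R * (m%:~R + 1))%:P * gegenz (m + 1).
Proof.
rewrite gegenz_derivM.
have h := gegenz_rec m.
have -> : (2 * (m%:~R + nu))%:P * ((m%:~R + 2 * nu)%:P * ('X * gegenz m) -
   (m%:~R + 1)%:P * gegenz (m + 1)) =
  (m%:~R + 2 * nu)%:P * ((2 * (m%:~R + nu))%:P * ('X * gegenz m)) -
   (2 * (m%:~R + nu) * (m%:~R + 1))%:P * gegenz (m + 1) by ring.
by rewrite h; ring.
Qed.

(** Gegenbauer's differential equation, obtained by differentiating [gegenz_derivM]. *)
Lemma pearson_gegenz_deriv (m : int) :
  pearson nu (gegenz m)^`() = - (m%:~R * (m%:~R + 2 * nu)) *: gegenz m.
Proof.
have := congr1 (@deriv R) (gegenz_derivM m).
rewrite /pearson !(derivD, derivB, derivN, derivM, derivC, derivX, derivXn, mul0r, add0r, mul1r).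
rewrite (gegenz_deriv1 m) -!mul_polyC => h.
have -> : (1 - 'X^2) * (gegenz m)^`()^`() =
   'X^(2.-1) *- 2 * (gegenz m)^`() + (1 - 'X^2) * ((gegenz m)^`())^`()
   + 2 * 'X * (gegenz m)^`() by rewrite /= expr1; ring.
by rewrite h; ring.
Qed.

End gegenbauer_polynomials.

Arguments gegenz : simpl never.

Lemma horner_gegen (R : realType) (nu : R) n x :
  0 < nu -> (gegen nu n).[x] = gegenbauer nu n x.
Proof.
move=> nu0; rewrite horner_sum; apply: eq_bigr => k _.
rewrite hornerZ hornerXn exprMn mulrA; congr (_ * _).
have kn : (k <= n)%N by have := ltn_ord k; lia.
have -> : nu + n%:R - k%:R = nu + (n - k)%:R by rewrite natrB// addrA.
rewrite Gamma_poch// /gegen_coef (_ : (n - 2 * k + k = n - k)%N); last first.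
  by have := ltn_ord k; lia.
have G0 := Gamma_gt0 nu0.
by rewrite natrM; field; rewrite (gt_eqF G0) !pnatr_eq0 -!lt0n !fact_gt0.
Qed.

(** * Entries of the weight *)

Section weight_entries.
Variables (R : realType) (nu : R) (L : nat).
Hypothesis nu_gt0 : 0 < nu.

(* The coefficient alpha_k(i,j) of the weight, up to factors depending on i or on j alone, in the
   variables p = i - k, q = j - k and r = L - i - j + k. *)
Definition wcoef p q k r : R :=
  (p + q)`!%:R * ((p + q)%:R + nu) / poch (2 * nu) (p + q) / poch nu (p + q + k).+1
  * (poch nu p / p`!%:R) * (poch nu q / q`!%:R)
  * ((-1) ^+ k * poch (- L%:R - nu) k / k`!%:R) / r`!%:R.

Let poch_neq0 (a : R) n : 0 < a -> poch a n != 0.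
Proof. by move=> a0; rewrite gt_eqF ?poch_gt0. Qed.

Let nu2_gt0 : 0 < 2 * nu. Proof. by rewrite mulr_gt0. Qed.

Let natD_neq0 n (a : R) : 0 < a -> n%:R + a != 0.
Proof. by move=> a0; rewrite gt_eqF// ltr_wpDl. Qed.

Let natr_ge0 n : 0 <= n%:R :> R. Proof. exact: ler0n. Qed.

Ltac nonzero :=
  repeat match goal with |- is_true (_ && _) => apply/andP; split end;
  first [assumption | by [] | apply: lt0r_neq0; lra].

(** This lemma and the next three are ratios of [wcoef] under unit shifts. The first two evaluate
    the two terms of [wterm_up], the last two those of [wterm_down]. *)
Lemma wcoef_pS p q k r :
  (p + q).+1%:R * r.+1%:R * (p%:R + nu)
    / (((p + q)%:R + nu) * ((p + q)%:R + 2 * nu)) * wcoef p q k r.+1 =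
  wcoef p.+1 q k r * (p.+1%:R * ((p + q + k).+1%:R + nu) / ((p + q).+1%:R + nu)).
Proof.
rewrite /wcoef !(addnS, addSn) !(factS, pochS) !natrM.
have := (poch_neq0 (p + q) nu2_gt0); have := (poch_neq0 (p + q + k) nu_gt0).
have := fact_neq0 R p; have := fact_neq0 R q; have := fact_neq0 R k; have := fact_neq0 R r.
move=> ? ? ? ? ? ?; have n0 := nu_gt0.
have p0 := natr_ge0 p; have q0 := natr_ge0 q; have k0 := natr_ge0 k; have r0 := natr_ge0 r.
field; nonzero.
Qed.

Lemma wcoef_qS P q k s :
  ((P + q)%:R + 2 * nu) * q.+1%:R * (L%:R + nu - k%:R)
    / (((P + q).+1%:R + nu) * (P + q).+1%:R) * wcoef P q.+1 k s =
  wcoef P q k.+1 s * (k.+1%:R * (q%:R + nu) / ((P + q)%:R + nu)).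
Proof.
rewrite /wcoef !(addnS, addSn) !(factS, pochS) !natrM.
have := (poch_neq0 (P + q) nu2_gt0); have := (poch_neq0 (P + q + k) nu_gt0).
have := fact_neq0 R P; have := fact_neq0 R q; have := fact_neq0 R k; have := fact_neq0 R s.
move=> ? ? ? ? ? ?; have n0 := nu_gt0; rewrite exprS.
have p0 := natr_ge0 P; have q0 := natr_ge0 q; have k0 := natr_ge0 k; have s0 := natr_ge0 s.
field; nonzero.
Qed.

Lemma wcoef_kS p q k r :
  (p + q).+1%:R * k.+1%:R * (q%:R + nu)
    / (((p + q)%:R + nu) * ((p + q)%:R + 2 * nu)) * wcoef p q k.+1 r =
  wcoef p q.+1 k r * (q.+1%:R * (L%:R + nu - k%:R) / ((p + q).+1%:R + nu)).
Proof.
rewrite /wcoef !(addnS, addSn) !(factS, pochS) !natrM.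
have := (poch_neq0 (p + q) nu2_gt0); have := (poch_neq0 (p + q + k) nu_gt0).
have := fact_neq0 R p; have := fact_neq0 R q; have := fact_neq0 R k; have := fact_neq0 R r.
move=> ? ? ? ? ? ?; have n0 := nu_gt0; rewrite exprS.
have p0 := natr_ge0 p; have q0 := natr_ge0 q; have k0 := natr_ge0 k; have r0 := natr_ge0 r.
field; nonzero.
Qed.

Lemma wcoef_rS p q k r :
  ((p + q)%:R + 2 * nu) * p.+1%:R * ((p + q + k).+1%:R + nu)
    / (((p + q).+1%:R + nu) * (p + q).+1%:R) * wcoef p.+1 q k r =
  wcoef p q k r.+1 * (r.+1%:R * (p%:R + nu) / ((p + q)%:R + nu)).
Proof.
rewrite /wcoef !(addnS, addSn) !(factS, pochS) !natrM.
have := (poch_neq0 (p + q) nu2_gt0); have := (poch_neq0 (p + q + k) nu_gt0).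
have := fact_neq0 R p; have := fact_neq0 R q; have := fact_neq0 R k; have := fact_neq0 R r.
move=> ? ? ? ? ? ?; have n0 := nu_gt0.
have p0 := natr_ge0 p; have q0 := natr_ge0 q; have k0 := natr_ge0 k; have r0 := natr_ge0 r.
field; nonzero.
Qed.

Definition wscale i : R := (i`! * (L - i)`!)%:R.

(** The summation range max(0, i + j - L) <= k <= min(i, j), stated without subtraction. *)
Definition wguard i j k := [&& k <= i, k <= j & i + j <= L + k]%N.

Lemma wguardE i j k : wguard i j k ->
  exists p q r, [/\ i = p + k, j = q + k & L = p + q + k + r]%N.
Proof.
rewrite /wguard => g.
by exists (i - k)%N, (j - k)%N, (L + k - (i + j))%N; split; lia.
Qed.

Definition wterm i j k : R :=
  if wguard i j k then
    (L%:R + nu) / L`!%:R * wscale i * wscale j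
    * wcoef (i - k) (j - k) k (L + k - (i + j))
  else 0.

Lemma wtermE i j k : wguard i j k -> wterm i j k = alpha nu L k i j.
Proof.
move=> g; rewrite /wterm g /wcoef /alpha /wscale.
case/and3P: g => ki kj ijL.
have -> : (i - k + (j - k) = i + j - 2 * k)%N by lia.
have -> : (i + j - 2 * k + k = i + j - k)%N by lia.
rewrite pochS !natrM.
have := (poch_neq0 (i + j - 2 * k) nu2_gt0); have := (poch_neq0 (i + j - k) nu_gt0).
have := fact_neq0 R (i - k); have := fact_neq0 R (j - k); have := fact_neq0 R k.
have := fact_neq0 R (L + k - (i + j)); have := fact_neq0 R L.
move=> ? ? ? ? ? ? ?; have n0 := nu_gt0; have := natr_ge0 (i + j - k) => ?.
have n1 := natD_neq0 (i + j - k) n0.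
field; nonzero.
Qed.

Lemma wtermC i j k : wterm i j k = wterm j i k.
Proof.
rewrite /wterm /wguard andbCA [(i + j)%N]addnC; case: ifP => // _.
rewrite /wcoef [(i - k + _)%N]addnC; ring.
Qed.

(* Coefficients of C_(m+1) and C_(m-1), m = i + j - 2 k, that the k-th terms of the entries (i+1, j)
   and (i-1, j) receive from the k-th term of the entry (i, j). *)
Definition upA i j k : R := let m := (i + j - 2 * k)%N in
  m.+1%:R * (L + k - (i + j))%:R * ((i - k)%:R + nu) / ((m%:R + nu) * (m%:R + 2 * nu)).
Definition upB i j k : R := let m := (i + j - 2 * k)%N in
  (m%:R + 2 * nu - 1) * (j - k)%:R * (L%:R + nu - k%:R) / ((m%:R + nu) * m%:R).
Definition downA i j k : R := let m := (i + j - 2 * k)%N in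
  m.+1%:R * k%:R * ((j - k)%:R + nu) / ((m%:R + nu) * (m%:R + 2 * nu)).
Definition downB i j k : R := let m := (i + j - 2 * k)%N in
  (m%:R + 2 * nu - 1) * (i - k)%:R * ((i + j - k)%:R + nu) / ((m%:R + nu) * m%:R).

(** All terms belong to degree i + j + 1 - 2 k. With P = i + 1 - k and q = j - k the two
    contributions add up because P (P + q + k + nu) + k (q + nu) = (P + k)(P + q + nu), and P + k =
    i + 1 is absorbed by [wscale]. *)
Lemma wterm_up i j k : (i <= L)%N ->
  (L - i)%:R * wterm i.+1 j k =
  upA i j k * wterm i j k + (if k is k'.+1 then upB i j k' * wterm i j k' else 0).
Proof.
move=> iL; have [g|g] := boolP (wguard i.+1 j k); last first.
  (* If the left term is out of range but a right term is not, then the factor L + k - i - j of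
     [upA], or the factor j - k of [upB], is 0. *)
  rewrite /wterm (negPf g) mulr0; apply/esym.
  have -> : upA i j k * (if wguard i j k then
      (L%:R + nu) / L`!%:R * wscale i * wscale j
      * wcoef (i - k) (j - k) k (L + k - (i + j)) else 0) = 0.
    case: ifP => [g'|_]; last by rewrite mulr0.
    have -> : upA i j k = 0; last by rewrite mul0r.
    rewrite /upA (_ : (L + k - (i + j) = 0)%N) ?mulr0 ?mul0r//.
    by move: g g'; rewrite /wguard; lia.
  rewrite add0r; case: k g => // k g.
  case: ifP => [g'|_]; last by rewrite mulr0.
  have -> : upB i j k = 0; last by rewrite mul0r.
  rewrite /upB (_ : (j - k = 0)%N) ?mulr0 ?mul0r//.
  by move: g g'; rewrite /wguard; lia.
case/and3P: (g) => ki kj ijL.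
have [P [q [s [iE jE LE]]]] : exists P q s, [/\ i.+1 = P + k, j = q + k & L = P + q + k + s]%N.
  by exists (i.+1 - k)%N, (j - k)%N, (L + k - (i.+1 + j))%N; split; lia.
rewrite [in LHS]/wterm g.
have kapE : (L - i)%:R * wscale i.+1 = (P + k)%:R * wscale i.
  rewrite /wscale -natrM mulnA -iE.
  have -> : (L - i = (L - i.+1).+1)%N by lia.
  by rewrite -!natrM !factS; congr (_%:R); lia.
have -> : (i.+1 - k = P)%N by lia.
have -> : (j - k = q)%N by lia.
have -> : (L + k - (i.+1 + j) = s)%N by lia.
have hB : upA i j k * wterm i j k = (L%:R + nu) / L`!%:R * wscale i * wscale j
   * (wcoef P q k s * (P%:R * ((P + q + k)%:R + nu) / ((P + q)%:R + nu))).
  case: P iE {kapE} LE => [|p] iE LE.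
    rewrite /wterm /wguard (_ : (k <= i)%N = false) /= ?mulr0 ?mul0r ?mulr0//; lia.
  rewrite /wterm (_ : wguard i j k); last by rewrite /wguard; lia.
  have -> : (i - k = p)%N by lia.
  have -> : (j - k = q)%N by lia.
  have -> : (L + k - (i + j) = s.+1)%N by lia.
  rewrite addSn addSn -wcoef_pS /upA.
  have -> : (i + j - 2 * k = p + q)%N by lia.
  have -> : (i - k = p)%N by lia.
  have -> : (L + k - (i + j) = s.+1)%N by lia.
  ring.
have hC : (if k is k'.+1 then upB i j k' * wterm i j k' else 0) =
   (L%:R + nu) / L`!%:R * wscale i * wscale j
   * (wcoef P q k s * (k%:R * (q%:R + nu) / ((P + q)%:R + nu))).
  case: k ki kj ijL {g} iE jE LE {kapE hB} => [|k] ki kj ijL iE jE LE.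
    by rewrite !mul0r !mulr0.
  rewrite /wterm (_ : wguard i j k); last by rewrite /wguard; lia.
  have -> : (i - k = P)%N by lia.
  have -> : (j - k = q.+1)%N by lia.
  have -> : (L + k - (i + j) = s)%N by lia.
  rewrite -wcoef_qS /upB.
  have -> : (i + j - 2 * k = (P + q).+1)%N by lia.
  have -> : (j - k = q.+1)%N by lia.
  rewrite -[in (P + q).+1%:R + 2 * nu - 1]natr1.
  ring.
rewrite hB hC.
have n0 := nu_gt0.
have p0 := natr_ge0 P; have q0 := natr_ge0 q; have k0 := natr_ge0 k; have s0 := natr_ge0 s.
have -> : (L - i)%:R * ((L%:R + nu) / L`!%:R * wscale i.+1 * wscale j * wcoef P q k s) =
   (L%:R + nu) / L`!%:R * wscale j * wcoef P q k s * ((L - i)%:R * wscale i.+1) by ring.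
rewrite kapE; have L0 := fact_neq0 R L.
field; nonzero.
Qed.

(** The index k - 1 on the left makes the degrees agree. In the notation of the proof the
    contributions add up because Q (L + nu - k) + r (p + nu) = (Q + r)(p + Q + nu) when L = p + Q +
    k + r. *)
Lemma wterm_down i j k : (i <= L)%N ->
  (if k is k'.+1 then i%:R * wterm i.-1 j k' else 0) =
  downA i j k * wterm i j k + (if k is k'.+1 then downB i j k' * wterm i j k' else 0).
Proof.
case: k => [|k]; first by rewrite /downA mulr0 !mul0r addr0.
case: i => [|i] iL.
  rewrite mul0r {1}/wterm /wguard /= mulr0 add0r.
  by rewrite /downB sub0n mulr0 !mul0r.
rewrite /=; have [g|g] := boolP (wguard i j k); last first.
  rewrite {1 2}/wterm (negPf g) mulr0 (_ : wguard _ _ _ = false) ?mulr0 ?add0r; last first.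
    by move: g; rewrite /wguard; lia.
  rewrite /wterm; case: ifP => [g'|_]; last by rewrite mulr0.
  rewrite /downB (_ : (i.+1 - k = 0)%N) ?mulr0 ?mul0r//.
  by move: g g'; rewrite /wguard; lia.
case/and3P: (g) => ki kj ijL.
have [p [Q [r [iE jE LE]]]] : exists p Q r, [/\ i = p + k, j = Q + k & L = p + Q + k + r]%N.
  by exists (i - k)%N, (j - k)%N, (L + k - (i + j))%N; split; lia.
rewrite [in LHS]/wterm g.
have kapE : i.+1%:R * wscale i = (Q + r)%:R * wscale i.+1.
  rewrite /wscale -natrM.
  have LiE : (L - i = (L - i.+1).+1)%N by lia.
  have -> : (Q + r = (L - i.+1).+1)%N by lia.
  by rewrite LiE -!natrM !factS; congr (_%:R); lia.
have -> : (i - k = p)%N by lia.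
have -> : (j - k = Q)%N by lia.
have -> : (L + k - (i + j) = r)%N by lia.
have hB : downA i.+1 j k.+1 * wterm i.+1 j k.+1 = (L%:R + nu) / L`!%:R * wscale i.+1 * wscale j
   * (wcoef p Q k r * (Q%:R * (L%:R + nu - k%:R) / ((p + Q)%:R + nu))).
  case: Q jE {kapE} LE => [|q] jE LE.
    rewrite /wterm /wguard (_ : (k < j)%N = false) /= ?andbF ?mulr0 ?mul0r ?mulr0//; lia.
  rewrite /wterm (_ : wguard _ _ _); last by rewrite /wguard; lia.
  have -> : (i.+1 - k.+1 = p)%N by lia.
  have -> : (j - k.+1 = q)%N by lia.
  have -> : (L + k.+1 - (i.+1 + j) = r)%N by lia.
  rewrite addnS -wcoef_kS /downA.
  have -> : (i.+1 + j - 2 * k.+1 = p + q)%N by lia.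
  have -> : (j - k.+1 = q)%N by lia.
  ring.
have hC : downB i.+1 j k * wterm i.+1 j k =
   (L%:R + nu) / L`!%:R * wscale i.+1 * wscale j
   * (wcoef p Q k r * (r%:R * (p%:R + nu) / ((p + Q)%:R + nu))).
  case: r LE {kapE hB} => [|r] LE.
    rewrite /wterm /wguard (_ : (i.+1 + j <= L + k)%N = false) ?andbF ?mulr0 ?mul0r ?mulr0//; lia.
  rewrite /wterm (_ : wguard _ _ _); last by rewrite /wguard; lia.
  have -> : (i.+1 - k = p.+1)%N by lia.
  have -> : (j - k = Q)%N by lia.
  have -> : (L + k - (i.+1 + j) = r)%N by lia.
  rewrite -wcoef_rS /downB.
  have -> : (i.+1 + j - 2 * k = (p + Q).+1)%N by lia.
  have -> : (i.+1 - k = p.+1)%N by lia.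
  have -> : (i.+1 + j - k = (p + Q + k).+1)%N by lia.
  rewrite -[in (p + Q).+1%:R + 2 * nu - 1]natr1.
  ring.
rewrite hB hC.
have n0 := nu_gt0.
have p0 := natr_ge0 p; have q0 := natr_ge0 Q; have k0 := natr_ge0 k; have r0 := natr_ge0 r.
have -> : i.+1%:R * ((L%:R + nu) / L`!%:R * wscale i * wscale j * wcoef p Q k r) =
   (L%:R + nu) / L`!%:R * wscale j * wcoef p Q k r * (i.+1%:R * wscale i) by ring.
rewrite kapE; have L0 := fact_neq0 R L; rewrite (_ : L%:R = p%:R + Q%:R + k%:R + r%:R); last first.
  by rewrite LE !natrD.
field; nonzero.
Qed.

Definition wpoly i j : {poly R} :=
  \sum_(k < L.+1) wterm i j k *: gegenz nu (i + j - 2 * k)%N%:Z.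

(* Gegenbauer's equation makes this a preimage of [wpoly i j] under [pearson], except for the
   constant term (where the denominator is 0), which only occurs for i = j. *)
Definition wpolyT i j : {poly R} :=
  \sum_(k < L.+1) - (wterm i j k / ((i + j - 2 * k)%:R * ((i + j - 2 * k)%:R + 2 * nu)))
     *: (gegenz nu (i + j - 2 * k)%N%:Z)^`().

Lemma wpolyC i j : wpoly i j = wpoly j i.
Proof. by apply: eq_bigr => k _; rewrite wtermC [(i + j)%N]addnC. Qed.

Lemma wpolyTC i j : wpolyT i j = wpolyT j i.
Proof. by apply: eq_bigr => k _; rewrite wtermC [(i + j)%N]addnC. Qed.

Let idx i j k : int := i%:Z + j%:Z - 2 * k%:Z.

Let wtermZ i j k (G : int -> {poly R}) :
  wterm i j k *: G (i + j - 2 * k)%N%:Z = wterm i j k *: G (idx i j k).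
Proof.
have [g|g] := boolP (wguard i j k); last by rewrite /wterm (negPf g) !scale0r.
by congr (_ *: G _); move: g; rewrite /wguard /idx; lia.
Qed.

(** Degrees drop by 2 when k grows by 1, so lowering the k-th term and raising the next one give the
    same degree. The hypothesis at L discards the lowered term that leaves the range. *)
Let shift_sum (w A B c : nat -> R) (ix : nat -> int) (G : int -> {poly R}) :
  (forall k, ix k.+1 = ix k - 2) ->
  (forall k, c k = A k * w k + (if k is k'.+1 then B k' * w k' else 0)) ->
  B L * w L = 0 ->
  \sum_(k < L.+1) c k *: G (ix k + 1) =
  \sum_(k < L.+1) w k *: (A k *: G (ix k + 1) + B k *: G (ix k - 1)).
Proof.
move=> ixS cE BL.
transitivity (\sum_(k < L.+1) (A k * w k) *: G (ix k + 1) +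
              \sum_(k < L.+1) (B k * w k) *: G (ix k - 1)).
  rewrite [X in _ = _ + X]big_ord_recr /= BL scale0r addr0.
  rewrite [LHS](eq_bigr (fun k : 'I__ => (A k * w k) *: G (ix k + 1) +
    (if nat_of_ord k is k'.+1 then B k' * w k' else 0) *: G (ix k + 1))).
    rewrite big_split/= [X in _ + X]big_ord_recl/= scale0r add0r.
    congr (_ + _); apply: eq_bigr => k _; congr (_ *: G _).
    by rewrite ixS; lia.
  by move=> k _; rewrite cE scalerDl.
by rewrite -big_split; apply: eq_bigr => k _; rewrite scalerDr !scalerA ![w k * _]mulrC.
Qed.

Lemma wpoly_up i j : (i <= L)%N -> (j <= L)%N ->
  (L - i)%:R *: wpoly i.+1 j =
  \sum_(k < L.+1) wterm i j k *: (upA i j k *: gegenz nu ((i + j - 2 * k)%N%:Z + 1)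
    + upB i j k *: gegenz nu ((i + j - 2 * k)%N%:Z - 1)).
Proof.
move=> iL jL.
rewrite [RHS](eq_bigr (fun k : 'I__ => wterm i j k *:
   (upA i j k *: gegenz nu (idx i j k + 1) + upB i j k *: gegenz nu (idx i j k - 1)))).
  rewrite -(@shift_sum _ _ _ (fun k => (L - i)%:R * wterm i.+1 j k)).
  - rewrite scaler_sumr; apply: eq_bigr => k _; rewrite -scalerA wtermZ.
    by congr (_ *: (_ *: gegenz nu _)); rewrite /idx; lia.
  - by move=> k; rewrite /idx; lia.
  - by move=> k; exact: wterm_up.
  - rewrite /wterm; case: ifP => [g|_]; last by rewrite mulr0.
    rewrite /upB (_ : (j - L = 0)%N) ?mulr0 ?mul0r//; lia.
move=> k _; exact: (wtermZ i j k (fun m => upA i j k *: gegenz nu (m + 1) +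
   upB i j k *: gegenz nu (m - 1))).
Qed.

Lemma wpoly_down i j : (i <= L)%N -> (j <= L)%N ->
  i%:R *: wpoly i.-1 j =
  \sum_(k < L.+1) wterm i j k *: (downA i j k *: gegenz nu ((i + j - 2 * k)%N%:Z + 1)
    + downB i j k *: gegenz nu ((i + j - 2 * k)%N%:Z - 1)).
Proof.
move=> iL jL.
rewrite [RHS](eq_bigr (fun k : 'I__ => wterm i j k *:
   (downA i j k *: gegenz nu (idx i j k + 1) + downB i j k *: gegenz nu (idx i j k - 1)))).
  rewrite -(@shift_sum _ _ _ (fun k => if k is k'.+1 then i%:R * wterm i.-1 j k' else 0)).
  - rewrite [RHS]big_ord_recl /= scale0r add0r scaler_sumr big_ord_recr /=.
    rewrite [X in _ + X](_ : _ = 0) ?addr0.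
      apply: eq_bigr => k _; rewrite wtermZ -scalerA.
      case: i iL => [|i] iL; first by rewrite !scale0r.
      by congr (_ *: (_ *: gegenz nu _)); rewrite /idx /= /bump; lia.
    case: i iL => [|i] iL; first by rewrite scale0r.
    by rewrite /wterm /wguard /= leqNgt iL /= scale0r scaler0.
  - by move=> k; rewrite /idx; lia.
  - by move=> k; exact: wterm_down.
  - rewrite /wterm; case: ifP => [g|_]; last by rewrite mulr0.
    rewrite /downB (_ : (i - L = 0)%N) ?mulr0 ?mul0r//; lia.
move=> k _; exact: (wtermZ i j k (fun m => downA i j k *: gegenz nu (m + 1) +
   downB i j k *: gegenz nu (m - 1))).
Qed.

Let gegenz_X (m : nat) : 'X * gegenz nu m%:Z =
  ((m%:R + 1) / (2 * (m%:R + nu))) *: gegenz nu (m%:Z + 1)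
  + ((m%:R + 2 * nu - 1) / (2 * (m%:R + nu))) *: gegenz nu (m%:Z - 1).
Proof.
have m0 : 2 * (m%:R + nu) != 0 by rewrite mulf_neq0 ?pnatr_eq0 ?natD_neq0.
apply: (scalerI m0); rewrite scalerDr !scalerA -mul_polyC.
rewrite (gegenz_rec nu m%:Z) -pmulrn !mul_polyC.
by congr (_ *: _ + _ *: _); field; rewrite natD_neq0.
Qed.

Let gegenz_dX (m : nat) : (1 - 'X^2) * (gegenz nu m%:Z)^`() =
  - (m%:R * (m%:R + 1) / (2 * (m%:R + nu))) *: gegenz nu (m%:Z + 1)
  + ((m%:R + 2 * nu) * (m%:R + 2 * nu - 1) / (2 * (m%:R + nu))) *: gegenz nu (m%:Z - 1).
Proof.
have m0 : 2 * (m%:R + nu) != 0 by rewrite mulf_neq0 ?pnatr_eq0 ?natD_neq0.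
apply: (scalerI m0); rewrite scalerDr !scalerA -mul_polyC.
rewrite (gegenz_deriv nu m%:Z) -pmulrn !mul_polyC addrC -scaleNr.
by congr (_ *: _ + _ *: _); field; rewrite natD_neq0.
Qed.

(** Both x C_m and (1 - x^2) C_m' are combinations of C_(m+1) and C_(m-1), so the identity is
    checked coefficient by coefficient. The right-hand side is skew in i and j, as the symmetry of
    the first order operator requires. *)
Lemma wpoly_E i j : (i <= L)%N -> (j <= L)%N ->
  (i%:R *+ 2 - L%:R) *: ('X * wpoly i j) + (L - i)%:R *: wpoly i.+1 j - i%:R *: wpoly i.-1 j
  = ((L%:R + 2 * nu) * (i%:R - j%:R)) *: ((1 - 'X^2) * wpolyT i j).
Proof.
move=> iL jL; rewrite wpoly_up// wpoly_down// /wpoly /wpolyT !mulr_sumr !scaler_sumr.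
rewrite -big_split -sumrB /=; apply: eq_bigr => k _.
have [g|g] := boolP (wguard i j k); last first.
  by rewrite /wterm (negPf g) !(mul0r, scale0r, oppr0, mulr0, scaler0, subr0, addr0).
rewrite -!scalerAr gegenz_X gegenz_dX.
set C1 := gegenz _ (_ + 1); set C2 := gegenz _ (_ - 1).
rewrite !(scalerDr, scalerA) opprD.
have lin (a1 a2 b1 b2 c1 c2 d1 d2 : R) : a1 + b1 - c1 = d1 -> a2 + b2 - c2 = d2 ->
  a1 *: C1 + a2 *: C2 + (b1 *: C1 + b2 *: C2) + (- (c1 *: C1) - c2 *: C2)
   = d1 *: C1 + d2 *: C2.
  by move=> <- <-; rewrite !scalerDl !scaleNr -!mul_polyC; ring.
have lin0 (a1 a2 b1 b2 c1 c2 d1 d2 : R) : C2 = 0 -> a1 + b1 - c1 = d1 ->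
  a1 *: C1 + a2 *: C2 + (b1 *: C1 + b2 *: C2) + (- (c1 *: C1) - c2 *: C2)
   = d1 *: C1 + d2 *: C2.
  by move=> -> <-; rewrite !scaler0 !scalerDl !scaleNr -!mul_polyC; ring.
have [p [q [r [iE jE LE]]]] := wguardE g.
have mE : (i + j - 2 * k = p + q)%N by lia.
have ikE : (i - k = p)%N by lia.
have jkE : (j - k = q)%N by lia.
have rE : (L + k - (i + j) = r)%N by lia.
have tE : (i + j - k = p + q + k)%N by lia.
move: (wterm i j k) => w; rewrite /upA /upB /downA /downB mE ikE jkE rE tE.
have -> : i%:R = p%:R + k%:R :> R by rewrite iE natrD.
have -> : j%:R = q%:R + k%:R :> R by rewrite jE natrD.
have -> : L%:R = p%:R + q%:R + k%:R + r%:R :> R by rewrite -!natrD -LE.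
have n0 := nu_gt0; have n2 := nu2_gt0.
have p0 := natr_ge0 p; have q0 := natr_ge0 q; have k0 := natr_ge0 k; have r0 := natr_ge0 r.
(* For m = 0 the coefficients of C_(m-1) contain a division by 0, but C_(-1) is 0; only C_(m+1) has
   to be compared. *)
have [pq0|pq0] := eqVneq (p + q)%N 0%N.
  have -> : p = 0%N by lia.
  have -> : q = 0%N by lia.
  apply: lin0; first by rewrite /C2 mE pq0.
  by rewrite !(addn0, add0n, mulr0n, mulr0, mul0r, subrr, oppr0, add0r); field; nonzero.
have pq : (p%:R + q%:R : R) != 0 by rewrite -natrD pnatr_eq0; lia.
by apply: lin; field; nonzero.
Qed.

(** The same comparison for the second order operator: the terms with [wpoly i j] are symmetric in i
    and j, the one with [wpolyT] is skew. *)
Lemma wpoly_D i j : (i <= L)%N -> (j <= L)%N ->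
  (L - i)%:R *: wpoly i.+1 j + i%:R *: wpoly i.-1 j
  = (1 - 'X^2) * (wpoly i j)^`() + L%:R *: ('X * wpoly i j)
    + ((i%:R - j%:R) * (L%:R - i%:R - j%:R)) *: ((1 - 'X^2) * wpolyT i j).
Proof.
move=> iL jL; rewrite wpoly_up// wpoly_down// /wpoly /wpolyT raddf_sum/= !mulr_sumr !scaler_sumr.
rewrite -!big_split /=; apply: eq_bigr => k _.
have [g|g] := boolP (wguard i j k); last first.
  by rewrite /wterm (negPf g) !(mul0r, scale0r, oppr0, deriv0, mulr0, scaler0, subr0, addr0).
rewrite derivZ -!scalerAr gegenz_X gegenz_dX.
set C1 := gegenz _ (_ + 1); set C2 := gegenz _ (_ - 1).
rewrite !(scalerDr, scalerA).
have lin (a1 a2 b1 b2 c1 c2 d1 d2 e1 e2 : R) : a1 + b1 = c1 + d1 + e1 -> a2 + b2 = c2 + d2 + e2 ->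
  a1 *: C1 + a2 *: C2 + (b1 *: C1 + b2 *: C2) =
  c1 *: C1 + c2 *: C2 + (d1 *: C1 + d2 *: C2) + (e1 *: C1 + e2 *: C2).
  move=> e1E e2E; have -> : a1 = c1 + d1 + e1 - b1 by rewrite -e1E addrK.
  have -> : a2 = c2 + d2 + e2 - b2 by rewrite -e2E addrK.
  by rewrite -!mul_polyC; ring.
have lin0 (a1 a2 b1 b2 c1 c2 d1 d2 e1 e2 : R) : C2 = 0 -> a1 + b1 = c1 + d1 + e1 ->
  a1 *: C1 + a2 *: C2 + (b1 *: C1 + b2 *: C2) =
  c1 *: C1 + c2 *: C2 + (d1 *: C1 + d2 *: C2) + (e1 *: C1 + e2 *: C2).
  move=> -> e1E; have -> : a1 = c1 + d1 + e1 - b1 by rewrite -e1E addrK.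
  by rewrite !scaler0 -!mul_polyC; ring.
have [p [q [r [iE jE LE]]]] := wguardE g.
have mE : (i + j - 2 * k = p + q)%N by lia.
have ikE : (i - k = p)%N by lia.
have jkE : (j - k = q)%N by lia.
have rE : (L + k - (i + j) = r)%N by lia.
have tE : (i + j - k = p + q + k)%N by lia.
move: (wterm i j k) => w; rewrite /upA /upB /downA /downB mE ikE jkE rE tE.
have -> : i%:R = p%:R + k%:R :> R by rewrite iE natrD.
have -> : j%:R = q%:R + k%:R :> R by rewrite jE natrD.
have -> : L%:R = p%:R + q%:R + k%:R + r%:R :> R by rewrite -!natrD -LE.
have n0 := nu_gt0; have n2 := nu2_gt0.
have p0 := natr_ge0 p; have q0 := natr_ge0 q; have k0 := natr_ge0 k; have r0 := natr_ge0 r.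
have [pq0|pq0] := eqVneq (p + q)%N 0%N.
  have -> : p = 0%N by lia.
  have -> : q = 0%N by lia.
  apply: lin0; first by rewrite /C2 mE pq0.
  by rewrite !(addn0, add0n, mulr0n, mulr0, mul0r, subrr, oppr0, add0r); field; nonzero.
have pq : (p%:R + q%:R : R) != 0 by rewrite -natrD pnatr_eq0; lia.
by apply: lin; field; nonzero.
Qed.

(** Gegenbauer's equation term by term. For distinct i and j no term has degree 0, where the
    eigenvalue m (m + 2 nu) could not be divided out. *)
Lemma pearson_wpolyT i j : i != j -> pearson nu (wpolyT i j) = wpoly i j.
Proof.
move=> ij; rewrite /pearson /wpolyT /wpoly raddf_sum/= !mulr_sumr scaler_sumr -sumrB.
apply: eq_bigr => k _.
have [g|g] := boolP (wguard i j k); last first.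
  by rewrite /wterm (negPf g) !(mul0r, scale0r, oppr0, deriv0, mulr0, scaler0, subr0, addr0).
have [p [q [r [iE jE LE]]]] := wguardE g.
have mE : (i + j - 2 * k = p + q)%N by lia.
rewrite mE derivZ -!scalerAr scalerA [_ * - _]mulrC -scalerA -scalerBr.
rewrite -/(pearson nu _) pearson_gegenz_deriv scalerA; congr (_ *: _).
have pq : (p%:R + q%:R : R) != 0 by rewrite -natrD pnatr_eq0; lia.
have n0 := nu_gt0; have p0 := natr_ge0 p; have q0 := natr_ge0 q.
by field; nonzero.
Qed.

Lemma weightE x (i j : 'I_L.+1) :
  weight nu L x i j = gweight nu x * (wpoly i j).[x].
Proof.
rewrite mxE; congr (_ * _).
rewrite big_geq_mkord (big_ord_widen_cond L.+1 (fun k => i + j - L <= k)%N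
  (fun k => alpha nu L k i j * gegenbauer nu (i + j - 2 * k) x)); last first.
  by have := ltn_ord i; lia.
rewrite horner_sum big_mkcond; apply: eq_bigr => k _ /=.
have -> : (i + j - L <= k)%N && (k < (minn i j).+1)%N = wguard i j k.
  by rewrite /wguard; lia.
rewrite hornerZ; case: ifPn => g; first by rewrite wtermE// horner_gegen.
by rewrite /wterm (negPf g) mul0r.
Qed.

(** The k-th term has degree i + j - 2 k = L - k - r, which reaches L only if k = r = 0, hence i + j
    = L. By this and the next two lemmas the coefficient of x^L in the weight is antidiagonal with
    nonzero entries. *)
Lemma coef_wpoly_gt i j n : (L < n)%N -> (wpoly i j)`_n = 0.
Proof.
move=> nL; rewrite coef_sum big1// => k _; rewrite coefZ.
have [g|g] := boolP (wguard i j k); last by rewrite /wterm (negPf g) mul0r.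
rewrite coef_gegen_eq0 ?mulr0// => s.
by have [p [q [r [? ? ?]]]] := wguardE g; lia.
Qed.

Lemma coef_wpoly_off i j : (i + j != L)%N -> (wpoly i j)`_L = 0.
Proof.
move=> ijL; rewrite coef_sum big1// => k _; rewrite coefZ.
have [g|g] := boolP (wguard i j k); last by rewrite /wterm (negPf g) mul0r.
rewrite coef_gegen_eq0 ?mulr0// => s.
by have [p [q [r [? ? ?]]]] := wguardE g; lia.
Qed.

Lemma coef_wpoly_antidiag i j : (i + j = L)%N -> (wpoly i j)`_L != 0.
Proof.
move=> ijL; rewrite coef_sum big_ord_recl big1 ?addr0 => [|k _]; last first.
  rewrite coefZ; have [g|g] := boolP (wguard i j (lift ord0 k)); last first.
    by rewrite /wterm (negPf g) mul0r.
  rewrite coef_gegen_eq0 ?mulr0// => s.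
  by have [p [q [r [? ? /=]]]] := wguardE g; rewrite /bump; lia.
rewrite coefZ /= muln0 subn0 ijL mulf_neq0//; last first.
  rewrite /gegenz -[in gegen _ L](addn0 L) -double0 coef_gegen /gegen_coef.
  by rewrite !mulf_neq0 ?invr_eq0 ?natrM ?mulf_neq0 ?fact_neq0 ?poch_neq0 ?expf_neq0 ?pnatr_eq0.
rewrite /wterm (_ : wguard i j 0); last by rewrite /wguard; lia.
rewrite /wscale /wcoef expr0 /poch [\prod_(m < 0) _]big_ord0.
rewrite !mulf_neq0 ?invr_eq0 ?natrM ?mulf_neq0 ?fact_neq0 ?natD_neq0 ?oner_eq0//;
  exact: (poch_neq0 _ nu_gt0) || exact: (poch_neq0 _ nu2_gt0).
Qed.

End weight_entries.

(** * The coefficients of the symmetric polynomials *)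

Section explicit_coefficients.
Variables (R : realType) (L : nat).

(** Zero at negative z, which is consistent with [risingS]: at z = -1 its factor z + 1 vanishes. *)
Definition rising (N : R) (z : int) : R :=
  if z is Posz n then poch N n / n`!%:R else 0.

Lemma risingS N z : (z%:~R + 1) * rising N (z + 1) = (N + z%:~R) * rising N z.
Proof.
case: z => [n|[|n]].
- have -> : Posz n + 1 = Posz n.+1 by rewrite -addn1 PoszD.
  rewrite /rising pochS factS natrM -[n%:~R]/(n%:R).
  by field; rewrite fact_neq0 natS_neq0.
- by rewrite [RHS]mulr0 NegzE addNr mul0r.
- have -> : Negz n.+1 + 1 = Negz n by rewrite !NegzE; lia.
  by rewrite !mulr0.
Qed.

(** The generalized binomial coefficient M (M - 1) ... (M - z + 1) / z!. *)
Definition falling (M : R) (z : int) : R := (-1) ^ z * rising (- M) z.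

Lemma fallingS M z : (z%:~R + 1) * falling M (z + 1) = (M - z%:~R) * falling M z.
Proof.
rewrite /falling mulrCA risingS expfzDr ?oppr_eq0 ?oner_eq0// expr1z; ring.
Qed.

(* Up to a factor independent of i and j, gamma(N; i, j, k) is [phi N a b c d] for
   a = (k+i-j)/2, b = (k-i+j)/2, c = (i+j-k)/2 and d = L - (i+j+k)/2. *)
Definition phi (N : R) (a b c d : int) : R :=
  (-1) ^ (a + b) * rising N c * rising N d
  * falling (N + L%:R) a * falling (N + L%:R) b.

Let sgnzB1 (z : int) : (-1 : R) ^ (z - 1) = - (-1) ^ z.
Proof.
rewrite -[in RHS](subrK 1 z) [in RHS]expfzDr ?oppr_eq0 ?oner_eq0//.
by rewrite expr1z mulrN1 opprK.
Qed.

(** The one-step relations of [rising] and [falling] bring the three terms to a common product. What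
    remains is (N + L - b + 1)(d + 1) + (N + c) a = (N + c + d + 1)(a + d + 1), which holds because
    L = a + b + c + d. *)
Lemma phi_rel (N : R) (a b c d : int) : a + b + c + d = L%:Z ->
  b%:~R * (N + d%:~R) * phi N a b c d
  + (c%:~R + 1) * (N + L%:R - a%:~R + 1) * phi N (a - 1) (b - 1) (c + 1) (d + 1)
  + (N + c%:~R + d%:~R + 1) * (a%:~R + d%:~R + 1) * phi N a (b - 1) c (d + 1) = 0.
Proof.
move=> abcd.
have LE : L%:R = a%:~R + b%:~R + c%:~R + d%:~R :> R by rewrite -!intrD abcd.
have := risingS N c; have := risingS N d.
have := fallingS (N + L%:R) (a - 1); have := fallingS (N + L%:R) (b - 1).
rewrite !subrK !intrB !subrK /phi => hb ha fd fc.
have -> : (-1 : R) ^ (a - 1 + (b - 1)) = (-1) ^ (a + b).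
  rewrite (_ : a - 1 + (b - 1) = a + b - 1 - 1); last by lia.
  by rewrite !sgnzB1 opprK.
have -> : (-1 : R) ^ (a + (b - 1)) = - (-1) ^ (a + b).
  by rewrite addrA sgnzB1.
set s := (-1) ^ (a + b).
transitivity (s * rising N c * falling (N + L%:R) a * (b%:~R * falling (N + L%:R) b)
    * ((N + d%:~R) * rising N d)
  + s * ((c%:~R + 1) * rising N (c + 1)) * rising N (d + 1) *
     ((N + L%:R - (a%:~R - 1)) * falling (N + L%:R) (a - 1)) * falling (N + L%:R) (b - 1)
  - (N + c%:~R + d%:~R + 1) * (a%:~R + d%:~R + 1) * s *
    rising N c * rising N (d + 1) * falling (N + L%:R) a * falling (N + L%:R) (b - 1)).
  ring.
rewrite hb -fd fc -ha LE; ring.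
Qed.

Lemma phiC N a b c d : phi N a b c d = phi N b a c d.
Proof. by rewrite /phi [(a + b)%R]addrC; ring. Qed.

Lemma phiCr N a b c d : phi N a b c d = phi N a b d c.
Proof. by rewrite /phi; ring. Qed.

(** All indices are integers, because the vanishing outside the ranges ([Phi_eq0], [Phi_col_eq0])
    takes care of every boundary convention for F. *)
Definition Phi (N : R) (i j k : int) : R :=
  let c := ((i + j - k) %/ 2)%Z in
  if (2 %| i + j - k)%Z then phi N (i - c) (j - c) c (L%:Z - i - j + c) else 0.

Lemma Phi_sym N i j k : Phi N i j k = Phi N j i k.
Proof.
rewrite /Phi (addrC j i); case: ifP => // _.
by rewrite phiC; congr phi; ring.
Qed.

Let even_idx (i j k : int) : (2 %| i + j - k)%Z ->
  exists c : int, [/\ k = i + j - 2 * c, ((i + j - k) %/ 2)%Z = c,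
    ((i + j - (k - 2)) %/ 2)%Z = c + 1, ((i + (j - 1) - (k - 1)) %/ 2)%Z = c &
    ((i + (j + 1) - (k - 1)) %/ 2)%Z = c + 1].
Proof.
move=> ev; exists ((i + j - k) %/ 2)%Z; split; lia.
Qed.

Lemma Phi_rel1 (N : R) (i j k : int) :
  (k - i + j)%:~R * (2 * (N + L%:R) - (i + j + k)%:~R) * Phi N i j k
  + (i + j - k + 2)%:~R * (2 * (N + L%:R) - (k + i - j - 2)%:~R) * Phi N i j (k - 2)
  + 4 * (N + L%:R - k%:~R + 1) * (L%:R - j%:~R + 1) * Phi N i (j - 1) (k - 1) = 0.
Proof.
rewrite /Phi.
have -> : (2 %| i + j - (k - 2))%Z = (2 %| i + j - k)%Z by lia.
have -> : (2 %| i + (j - 1) - (k - 1))%Z = (2 %| i + j - k)%Z by lia.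
case: ifP => ev; last by rewrite !mulr0 !addr0.
have [c [kE -> -> -> _]] := even_idx ev.
have abcd : (i - c) + (j - c) + c + (L%:Z - i - j + c) = L%:Z by lia.
have := phi_rel N abcd.
rewrite (_ : i - c - 1 = i - (c + 1)); last by lia.
rewrite (_ : j - c - 1 = j - (c + 1)); last by lia.
rewrite (_ : L%:Z - i - j + c + 1 = L%:Z - i - j + (c + 1)); last by lia.
rewrite (_ : j - 1 - c = j - (c + 1)); last by lia.
rewrite (_ : L%:Z - i - (j - 1) + c = L%:Z - i - j + (c + 1)); last by lia.
move: (phi _ _ _ _ _) (phi _ _ _ _ _) (phi _ _ _ _ _) => x y z H.
rewrite kE -[RHS](mulr0 4) -[in RHS]H; ring.
Qed.

(** [phi] is symmetric in a, b and in c, d. Swapping both pairs in [phi_rel] replaces the neighbour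
    j - 1 by j + 1. *)
Lemma Phi_rel2 (N : R) (i j k : int) :
  (k + i - j)%:~R * (2 * N + (i + j - k)%:~R) * Phi N i j k
  + (2 * L%:R - (i + j + k - 2)%:~R) * (2 * (N + L%:R) - (k - i + j - 2)%:~R) * Phi N i j (k - 2)
  + 4 * (N + L%:R - k%:~R + 1) * (j%:~R + 1) * Phi N i (j + 1) (k - 1) = 0.
Proof.
rewrite /Phi.
have -> : (2 %| i + j - (k - 2))%Z = (2 %| i + j - k)%Z by lia.
have -> : (2 %| i + (j + 1) - (k - 1))%Z = (2 %| i + j - k)%Z by lia.
case: ifP => ev; last by rewrite !mulr0 !addr0.
have [c [kE -> -> _ ->]] := even_idx ev.
have abcd : (j - c) + (i - c) + (L%:Z - i - j + c) + c = L%:Z by lia.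
have := phi_rel N abcd; rewrite !(phiC _ (j - _)) !(phiCr _ _ _ (L%:Z - _ - _ + _)).
rewrite (phiC _ (j - c - 1)) (phiCr _ _ _ (L%:Z - _ - _ + _ + 1)).
rewrite (_ : i - c - 1 = i - (c + 1)); last by lia.
rewrite (_ : j - c - 1 = j - (c + 1)); last by lia.
rewrite (_ : L%:Z - i - j + c + 1 = L%:Z - i - j + (c + 1)); last by lia.
rewrite (_ : j + 1 - (c + 1) = j - c); last by lia.
rewrite (_ : L%:Z - i - (j + 1) + (c + 1) = L%:Z - i - j + c); last by lia.
move: (phi _ _ _ _ _) (phi _ _ _ _ _) (phi _ _ _ _ _) => x y z H.
rewrite kE -[RHS](mulr0 4) -[in RHS]H; ring.
Qed.

Lemma phi_eq0 N (a b c d : int) :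
  ~~ [&& 0 <= a, 0 <= b, 0 <= c & 0 <= d] -> phi N a b c d = 0.
Proof.
have neg z : z < 0 -> rising N z = 0 /\ falling (N + L%:R) z = 0.
  by case: z => // z _; rewrite /falling /= mulr0.
have [/neg[_ h]|?] := ltP a 0; first by rewrite /phi h !(mul0r, mulr0).
have [/neg[_ h]|?] := ltP b 0; first by rewrite /phi h !(mul0r, mulr0).
have [/neg[h _]|?] := ltP c 0; first by rewrite /phi h !(mul0r, mulr0).
by have [/neg[h _]|?] := ltP d 0; first by rewrite /phi h !(mul0r, mulr0).
Qed.

Lemma Phi_eq0 N (i j k : int) : k < 0 \/ L%:Z < k -> Phi N i j k = 0.
Proof.
rewrite /Phi; case: ifP => // ev k0; have [c [kE -> _ _ _]] := even_idx ev.
apply: phi_eq0; lia.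
Qed.

Let binR (n m : nat) : (m <= n)%N -> 'C(n, m)%:R = n`!%:R / (m`!%:R * (n - m)`!%:R) :> R.
Proof.
move=> mn; rewrite -(bin_fact mn) !natrM mulfK// mulf_neq0// fact_neq0.
Qed.

Lemma falling_poch (M : R) n : n`!%:R * falling M n%:Z = poch (M + 1 - n%:R) n.
Proof.
elim: n => [|n IH]; first by rewrite /falling /= /poch !big_ord0 fact0 expr0z divr1 !mulr1.
have := fallingS M n%:Z; rewrite (_ : n%:Z + 1 = n.+1); last by rewrite -addn1 PoszD.
move=> h; rewrite factS natrM -natr1 mulrAC -[n%:R]/(n%:~R) h -[n%:~R]/(n%:R).
rewrite -mulrA [falling _ _ * _]mulrC IH [RHS]/poch big_ord_recl /= addr0.
congr (_ * _); first by ring.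
apply: eq_bigr => m _; rewrite /bump leq0n add1n -natr1; ring.
Qed.

Definition gam_const (N : R) : R :=
  (N + L%:R) * L`!%:R * Gamma N / Gamma (N + L%:R + 1) ^+ 2.

(** The three binomials multiply to the multinomial L! / (a! b! c! d!), whose denominators are those
    of [rising] and [falling]. The Gamma factors in the numerator give rising factorials over
    Gamma(N), those in the denominator falling ones over Gamma(N + L + 1). *)
Lemma gamE (N : R) (i j : nat) (k : int) : 0 < N -> (i <= L)%N -> (j <= L)%N ->
  gam N L i j k = gam_const N * (N + L%:R - k%:~R) * Phi N i j k.
Proof.
move=> N0 iL jL; rewrite /gam /Phi eqz_mod_dvd.
case: ifP => ev; last by rewrite mulr0.
have l2 : 2 * ell R L = L%:R by rewrite /ell mulrC divfK// pnatr_eq0.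
rewrite l2; have [c [kE -> _ _ _]] := even_idx ev.
have aE : ((k + i%:Z - j%:Z) %/ 2)%Z = i%:Z - c by lia.
have cE : ((i%:Z + j%:Z - k) %/ 2)%Z = c by lia.
rewrite aE.
have [pos|neg] := boolP [&& 0 <= i%:Z - c, 0 <= j%:Z - c, 0 <= c & 0 <= L%:Z - i%:Z - j%:Z + c];
    last first.
  rewrite phi_eq0// mulr0 /binz.
  case: ifP => h1; last by rewrite !(mulr0, mul0r).
  case: ifP => h2; last by rewrite !(mulr0, mul0r).
  case: ifP => h3; last by rewrite !(mulr0, mul0r).
  lia.
have [a [b [d [e [iE jE LE ceE]]]]] : exists a b d e : nat,
    [/\ i = (a + e)%N, j = (b + e)%N, L = (a + b + e + d)%N & c = e%:Z].
  exists (absz (i%:Z - c)), (absz (j%:Z - c)), (absz (L%:Z - i%:Z - j%:Z + c)), (absz c).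
  by split; lia.
have kN : k = (a + b)%N%:Z by lia.
have -> : i%:Z - c = a by lia.
have -> : j%:Z - c = b by lia.
have -> : L%:Z - i%:Z - j%:Z + c = d by lia.
rewrite kN ceE.
have -> : binz L (a + b)%N%:Z = 'C(L, a + b) by rewrite /binz ifT//; lia.
have -> : binz (a + b)%N%:Z a%:Z = 'C(a + b, a) by rewrite /binz ifT//; lia.
have -> : binz (L%:Z - (a + b)%N%:Z) e%:Z = 'C(e + d, e).
  rewrite (_ : L%:Z - (a + b)%N%:Z = (e + d)%N%:Z); last by lia.
  by rewrite /binz ifT//; lia.
rewrite !binR; [|lia..].
rewrite addKn addKn (_ : (L - (a + b) = e + d)%N); last by lia.
have LR : L%:R = a%:R + b%:R + e%:R + d%:R :> R by rewrite -!natrD -LE.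
have iR : i%:R = a%:R + e%:R :> R by rewrite -!natrD -iE.
have jR : j%:R = b%:R + e%:R :> R by rewrite -!natrD -jE.
have -> : N - ((a + b)%N%:~R - i%:R - j%:R) / 2 = N + e%:R.
  by rewrite iR jR; field.
have -> : N + L%:R - ((a + b)%N%:~R + i%:R + j%:R) / 2 = N + d%:R.
  by rewrite iR jR LR; field.
have -> : N + L%:R + 1 - ((a + b)%N%:~R - i%:R + j%:R) / 2 = N + L%:R + 1 - b%:R.
  by rewrite iR jR; field.
have -> : N + L%:R + 1 - ((a + b)%N%:~R + i%:R - j%:R) / 2 = N + L%:R + 1 - a%:R.
  by rewrite iR jR; field.
rewrite !Gamma_poch// /gam_const /phi /rising.
have GN : Gamma N != 0 by rewrite gt_eqF// Gamma_gt0.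
have gamB m : (m <= L)%N -> exists g, [/\ Gamma (N + L%:R + 1 - m%:R) = g, g != 0 &
    Gamma (N + L%:R + 1) = m`!%:R * falling (N + L%:R) m * g].
  move=> mL; exists (Gamma (N + L%:R + 1 - m%:R)).
  have mLR : m%:R <= L%:R :> R by rewrite ler_nat.
  have z0 : 0 < N + L%:R + 1 - m%:R by lra.
  split; first by [].
    by rewrite gt_eqF// Gamma_gt0.
  by rewrite falling_poch -(Gamma_poch _ z0) subrK.
have [|ga [-> ga0 Ga]] := gamB a; first by lia.
have [|gb [-> gb0 Gb]] := gamB b; first by lia.
have G0 : Gamma (N + L%:R + 1) != 0.
  by rewrite gt_eqF// Gamma_gt0// ltr_wpDr// ltr_wpDr.
have fa0 := fact_neq0 R a; have fb0 := fact_neq0 R b; have fd0 := fact_neq0 R d.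
have fe0 := fact_neq0 R e; have fL0 := fact_neq0 R L; have fab0 := fact_neq0 R (a + b).
have fed0 := fact_neq0 R (e + d).
have -> : falling (N + L%:R) a = Gamma (N + L%:R + 1) / (a`!%:R * ga).
  by rewrite Ga; field; rewrite ga0 fa0.
have -> : falling (N + L%:R) b = Gamma (N + L%:R + 1) / (b`!%:R * gb).
  by rewrite Gb; field; rewrite gb0 fb0.
have -> : (-1 : R) ^ (a%:Z + b%:Z) = (-1) ^+ (a + b) by rewrite -PoszD.
move: (Gamma N) (Gamma (N + L%:R + 1)) (poch N d) (poch N e) GN G0 {Ga Gb} => gN g pd pe GN G0.
by field; rewrite GN ga0 gb0 G0 fa0 fb0 fd0 fe0 fab0 fed0.
Qed.

Lemma Phi_col_eq0 N (i j k : int) : j < 0 \/ L%:Z < j -> Phi N i j k = 0.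
Proof.
rewrite /Phi; case: ifP => // ev j0; have [c [kE -> _ _ _]] := even_idx ev.
apply: phi_eq0; lia.
Qed.

End explicit_coefficients.

(** * Entries of the symmetric polynomials *)

Section explicit_polynomials.
Variables (R : realType) (L : nat) (nu : R) (n : nat).
Hypothesis nu_gt0 : 0 < nu.

Let N := nu + n%:R.
Let mu := nu + L%:R.
Let N_gt0 : 0 < N. Proof. by rewrite ltr_wpDr. Qed.

Definition Fconst : R := n`!%:R * Gamma (nu + L%:R) / 2 ^+ n * gam_const L N.

Lemma FmxE (k : int) (i j : 'I_L.+1) : k <= n%:Z ->
  Fmx nu L k n i j = Fconst * (N + L%:R - k%:~R) * Phi L N i%:Z j%:Z k.
Proof.
move=> kn; rewrite /Fmx; case: ifP => [_|kP]; last first.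
  by rewrite mxE Phi_eq0 ?mulr0//; lia.
have l2 : 2 * ell R L = L%:R by rewrite /ell mulrC divfK// pnatr_eq0.
rewrite mxE gamE ?l2//; [|by rewrite -ltnS|by rewrite -ltnS].
by rewrite /Fconst !mulrA.
Qed.

Lemma Fmx_sym (k : int) : k <= n%:Z -> (Fmx nu L k n)^T = Fmx nu L k n.
Proof. by move=> kn; apply/matrixP => i j; rewrite mxE !FmxE// Phi_sym. Qed.

(** Everything is collected at the index n - k + 1; n + 3 values of k then cover all three shifts. G
    will be the derivative of C_m, which vanishes at m = 0 and m = -1. *)
Let shift3 (U V W : int -> R) (G : int -> {poly R}) :
  (forall k, U k + V (k - 2) + W (k - 1) = 0) ->
  V (- 1) = 0 -> V (- 2) = 0 -> W (- 1) = 0 -> G 0 = 0 -> G (- 1) = 0 ->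
  \sum_(k < n.+1) (U k%:Z *: G (n%:Z - k%:Z + 1) + V k%:Z *: G (n%:Z - k%:Z - 1)
    + W k%:Z *: G (n%:Z - k%:Z)) = 0.
Proof.
move=> rel V1 V2 W1 G0 G1.
transitivity (\sum_(k < n.+3) (U k%:Z + V (k%:Z - 2) + W (k%:Z - 1)) *: G (n%:Z - k%:Z + 1)).
  rewrite [RHS](eq_bigr (fun k : 'I__ => U k%:Z *: G (n%:Z - k%:Z + 1)
     + V (k%:Z - 2) *: G (n%:Z - k%:Z + 1) + W (k%:Z - 1) *: G (n%:Z - k%:Z + 1))); last first.
    by move=> k _; rewrite !scalerDl.
  rewrite !big_split /=; congr (_ + _ + _).
  - rewrite [RHS]big_ord_recr big_ord_recr /=.
    rewrite (_ : n%:Z - n.+1%:Z + 1 = 0); last by lia.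
    rewrite (_ : n%:Z - n.+2%:Z + 1 = -1); last by lia.
    by rewrite G0 G1 !scaler0 !addr0.
  - rewrite [RHS]big_ord_recl big_ord_recl /= sub0r V2 scale0r add0r.
    rewrite (_ : (bump 0 0)%:Z - 2 = -1); last by [].
    rewrite V1 scale0r add0r; apply: eq_bigr => k _.
    by congr (V _ *: G _); rewrite /bump; lia.
  - rewrite [RHS]big_ord_recl [in RHS]big_ord_recr /= sub0r W1 scale0r add0r.
    rewrite (_ : n%:Z - (bump 0 n.+1)%:Z + 1 = -1); last by rewrite /bump; lia.
    rewrite G1 scaler0 addr0; apply: eq_bigr => k _.
    by congr (W _ *: G _); rewrite /bump; lia.
by rewrite big1// => k _; rewrite rel scale0r.
Qed.

Definition symgegen (i j : int) : {poly R} :=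
  \sum_(k < n.+1) (Fconst * (N + L%:R - k%:R) * Phi L N i j k%:Z) *: gegenz mu (n%:Z - k%:Z).

Let symgegen_deriv i j : (symgegen i j)^`() = \sum_(k < n.+1)
  (Fconst * (N + L%:R - k%:R) * Phi L N i j k%:Z) *: (gegenz mu (n%:Z - k%:Z))^`().
Proof. by rewrite /symgegen raddf_sum; apply: eq_bigr => k _; rewrite /= derivZ. Qed.

Let symgegen_deriv2 i j : (symgegen i j)^`()^`() = \sum_(k < n.+1)
  (Fconst * (N + L%:R - k%:R) * Phi L N i j k%:Z) *: (gegenz mu (n%:Z - k%:Z))^`()^`().
Proof. by rewrite symgegen_deriv raddf_sum; apply: eq_bigr => k _; rewrite /= derivZ. Qed.

Lemma symgegen_sym i j : symgegen i j = symgegen j i.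
Proof. by apply: eq_bigr => k _; rewrite Phi_sym. Qed.

Lemma symgegen_col_eq0 i j : j < 0 \/ L%:Z < j -> symgegen i j = 0.
Proof. by move=> j0; rewrite /symgegen big1// => k _; rewrite Phi_col_eq0// mulr0 scale0r. Qed.

(** Since N + L = n + mu, the factor N + L - k of F_(k,n) is (n - k) + mu, exactly what turns
    C_(n-k) into a difference of derivatives. *)
Let gegenz_half (k : nat) :
  (N + L%:R - k%:R)%:P * gegenz mu (n%:Z - k%:Z) =
    (2^-1)%:P * ((gegenz mu (n%:Z - k%:Z + 1))^`() - (gegenz mu (n%:Z - k%:Z - 1))^`()).
Proof.
rewrite -gegenz_deriv_diff mulrA -polyCM; congr (_%:P * _).
by rewrite intrB -!pmulrn /N /mu; field.
Qed.

Let gegenz_Xhalf (k : nat) :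
  (N + L%:R - k%:R)%:P * ('X * (gegenz mu (n%:Z - k%:Z))^`()) =
    (2^-1)%:P * ((n%:R - k%:R)%:P * (gegenz mu (n%:Z - k%:Z + 1))^`()
     + (n%:R - k%:R + 2 * mu)%:P * (gegenz mu (n%:Z - k%:Z - 1))^`()).
Proof.
have := gegenz_Xderiv_sum mu (n%:Z - k%:Z); rewrite intrB -!pmulrn => <-.
by rewrite [RHS]mulrA -polyCM; congr (_%:P * _); rewrite /N /mu; field.
Qed.

Lemma symgegen_E (i j : int) :
  (2 * j%:~R - L%:R) *: ('X * (symgegen i j)^`())
  + (L%:R - j%:~R + 1) *: (symgegen i (j - 1))^`() - (j%:~R + 1) *: (symgegen i (j + 1))^`()
  + ((L%:R + 2 * nu) * (j%:~R - i%:~R) - n%:R * (2 * i%:~R - L%:R)) *: symgegen i j = 0.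
Proof.
set s := (L%:R + 2 * nu) * _ - _.
(* U, V and W are the coefficients of the derivatives of C_(n-k+1), C_(n-k-1) and C_(n-k) in the
   k-th summand. *)
pose U k := Fconst * (2^-1 * Phi L N i j k * ((n%:R - k%:~R) * (2 * j%:~R - L%:R) + s)).
pose V k := Fconst * (2^-1 * Phi L N i j k * ((n%:R - k%:~R + 2 * mu) * (2 * j%:~R - L%:R) - s)).
pose W k := Fconst * ((N + L%:R - k%:~R) * ((L%:R - j%:~R + 1) * Phi L N i (j - 1) k
                           - (j%:~R + 1) * Phi L N i (j + 1) k)).
rewrite -[RHS](@shift3 U V W (fun z => (gegenz mu z)^`())).
- rewrite !symgegen_deriv /symgegen !mulr_sumr !scaler_sumr -sumrN -!big_split /=.
  apply: eq_bigr => k _; rewrite -!mul_polyC.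
  transitivity (((2 * j%:~R - L%:R) * Fconst * Phi L N i j k%:Z)%:P *
      ((N + L%:R - k%:R)%:P * ('X * (gegenz mu (n%:Z - k%:Z))^`()))
    + (W k%:Z)%:P * (gegenz mu (n%:Z - k%:Z))^`()
    + (s * Fconst * Phi L N i j k%:Z)%:P *
      ((N + L%:R - k%:R)%:P * gegenz mu (n%:Z - k%:Z))).
    rewrite /W -pmulrn; ring.
  rewrite gegenz_half gegenz_Xhalf /U /V -pmulrn; ring.
(* Up to [Fconst] the total coefficient is a quarter of [Phi_rel1] minus [Phi_rel2]. *)
- move=> k; rewrite /U /V /W -!mulrDr.
  have := Phi_rel1 L N i j k; have := Phi_rel2 L N i j k.
  move: (Phi _ _ _ _ _) (Phi _ _ _ _ _) (Phi _ _ _ _ _) (Phi _ _ _ _ _) => p1 p2 p3 p4 r2 r1.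
  rewrite [X in _ * X](_ : _ = 0) ?mulr0// /s.
  have nuE : nu = N - n%:R by rewrite /N addrK.
  rewrite /mu nuE.
  move: r1 r2; rewrite !(intrD, intrB); lra.
- by rewrite /V Phi_eq0 ?mulr0 ?mul0r ?mulr0//; left.
- by rewrite /V Phi_eq0 ?mulr0 ?mul0r ?mulr0//; left.
- by rewrite /W !Phi_eq0 ?mulr0 ?subr0 ?mulr0 ?mul0r//; left.
- by rewrite (_ : gegenz mu 0 = gegen mu 0)// gegen0 -polyC1 derivC.
- by rewrite (_ : gegenz mu (- 1) = 0)// deriv0.
Qed.

(** Gegenbauer's equation for C^(mu) has 2 mu + 1 = (L + 2 nu + 1) + L in its first order term; the
    surplus L x C' joins the other first order terms. What remains is a quarter of the sum of
    [Phi_rel1] and [Phi_rel2]. *)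
Lemma symgegen_D (i j : int) :
  (1 - 'X^2) * (symgegen i j)^`()^`() - (L%:R + 2 * nu + 1) *: ('X * (symgegen i j)^`())
  + ((L%:R - j%:~R + 1) *: (symgegen i (j - 1))^`() + (j%:~R + 1) *: (symgegen i (j + 1))^`())
  + (j%:~R * (L%:R - j%:~R)) *: symgegen i j
  = (i%:~R * (L%:R - i%:~R) - n%:R * (n%:R + L%:R + 2 * nu)) *: symgegen i j.
Proof.
pose s k := - ((n%:R - k%:~R) * (n%:R - k%:~R + 2 * mu)) +
  (j%:~R * (L%:R - j%:~R) - i%:~R * (L%:R - i%:~R) + n%:R * (n%:R + L%:R + 2 * nu)) : R.
pose U (k : int) := Fconst * (2^-1 * Phi L N i j k * (L%:R * (n%:R - k%:~R) + s k)).
pose V (k : int) := Fconst * (2^-1 * Phi L N i j k * (L%:R * (n%:R - k%:~R + 2 * mu) - s k)).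
pose W (k : int) := Fconst * ((N + L%:R - k%:~R) * ((L%:R - j%:~R + 1) * Phi L N i (j - 1) k
                           + (j%:~R + 1) * Phi L N i (j + 1) k)).
apply/eqP; rewrite -subr_eq0; apply/eqP.
rewrite -[RHS](@shift3 U V W (fun z => (gegenz mu z)^`())).
- rewrite symgegen_deriv2 !symgegen_deriv /symgegen !mulr_sumr !scaler_sumr -!sumrN -!big_split /=.
  apply: eq_bigr => k _; rewrite -!mul_polyC.
  have ode := pearson_gegenz_deriv mu (n%:Z - k%:Z).
  rewrite /pearson -!mul_polyC intrB -!pmulrn in ode.
  transitivity ((Fconst * Phi L N i j k%:Z * (N + L%:R - k%:R))%:P *
      ((1 - 'X^2) * (gegenz mu (n%:Z - k%:Z))^`()^`()
        - (2 * mu + 1)%:P * ('X * (gegenz mu (n%:Z - k%:Z))^`()))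
    + (L%:R * Fconst * Phi L N i j k%:Z)%:P *
      ((N + L%:R - k%:R)%:P * ('X * (gegenz mu (n%:Z - k%:Z))^`()))
    + (W k%:Z)%:P * (gegenz mu (n%:Z - k%:Z))^`()
    + ((s k%:Z + (n%:R - k%:R) * (n%:R - k%:R + 2 * mu)) * Fconst * Phi L N i j k%:Z)%:P *
      ((N + L%:R - k%:R)%:P * gegenz mu (n%:Z - k%:Z))).
    rewrite /W /s /mu -!pmulrn; ring.
  rewrite ode.
  transitivity ((L%:R * Fconst * Phi L N i j k%:Z)%:P *
      ((N + L%:R - k%:R)%:P * ('X * (gegenz mu (n%:Z - k%:Z))^`()))
    + (W k%:Z)%:P * (gegenz mu (n%:Z - k%:Z))^`()
    + (s k%:Z * Fconst * Phi L N i j k%:Z)%:P *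
      ((N + L%:R - k%:R)%:P * gegenz mu (n%:Z - k%:Z))); first by ring.
  rewrite gegenz_half gegenz_Xhalf /U /V -!pmulrn; ring.
- move=> k; rewrite /U /V /W -!mulrDr.
  have := Phi_rel1 L N i j k; have := Phi_rel2 L N i j k.
  move: (Phi _ _ _ _ _) (Phi _ _ _ _ _) (Phi _ _ _ _ _) (Phi _ _ _ _ _) => p1 p2 p3 p4 r2 r1.
  rewrite [X in _ * X](_ : _ = 0) ?mulr0// /s.
  have nuE : nu = N - n%:R by rewrite /N addrK.
  rewrite /mu nuE.
  move: r1 r2; rewrite !(intrD, intrB); lra.
- by rewrite /V Phi_eq0 ?mulr0 ?mul0r ?mulr0//; left.
- by rewrite /V Phi_eq0 ?mulr0 ?mul0r ?mulr0//; left.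
- by rewrite /W !Phi_eq0 ?mulr0 ?addr0 ?mulr0 ?mul0r//; left.
- by rewrite (_ : gegenz mu 0 = gegen mu 0)// gegen0 -polyC1 derivC.
- by rewrite (_ : gegenz mu (- 1) = 0)// deriv0.
Qed.

Lemma coef_symgegen_gt i j m : (n < m)%N -> (symgegen i j)`_m = 0.
Proof.
move=> nm; rewrite coef_sum big1// => k _; rewrite coefZ.
have kn : (k <= n)%N by rewrite -ltnS.
rewrite (_ : n%:Z - k%:Z = (n - k)%N%:Z); last by lia.
by rewrite /gegenz coef_gegen_eq0 ?mulr0// => s; lia.
Qed.

(** Only k = 0 reaches degree n, and there a + b = 0 forces i = j. The normalization n! Gamma(mu) /
    2^n times the leading coefficient 2^n (mu)_n / n! of C_n is Gamma(N + L). *)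
Lemma coef_symgegen (i j : 'I_L.+1) : (symgegen i%:Z j%:Z)`_n = Dmx nu L n i j.
Proof.
rewrite coef_sum big_ord_recl big1 ?addr0 => [|k _]; last first.
  rewrite coefZ; have kn : (lift ord0 k <= n)%N by rewrite -ltnS.
  rewrite (_ : n%:Z - (lift ord0 k)%:Z = (n - lift ord0 k)%N%:Z); last by lia.
  by rewrite /gegenz coef_gegen_eq0 ?mulr0// => s; move: kn; rewrite /= /bump; lia.
rewrite coefZ subr0 mxE mxE -val_eqE.
have [ij|ij] := eqVneq (val i) (val j); last first.
  rewrite mulr0n /Phi; case: ifP => ev; last by rewrite mulr0 mul0r.
  by rewrite phi_eq0 ?mulr0 ?mul0r//; move: ij => /=; lia.
have iL : (i <= L)%N by rewrite -ltnS.
have -> : Phi L N i%:Z j%:Z 0 = rising N i%:Z * rising N (L - i)%N%:Z.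
  rewrite /Phi -[j%:Z]/((val j)%:Z) -ij /= ifT; last by lia.
  have -> : ((i%:Z + i%:Z - 0) %/ 2)%Z = i by lia.
  rewrite subrr (_ : L%:Z - i%:Z - i%:Z + i%:Z = (L - i)%N%:Z); last by lia.
  have f0 : falling (N + L%:R) 0 = 1 :> R.
    by rewrite /falling expr0z mul1r -[0]/(Posz 0) /rising /poch big_ord0 fact0 divr1.
  by rewrite /phi f0 addr0 expr0z mul1r !mulr1.
have -> : (gegenz mu n%:Z)`_n = gegen_coef mu n 0.
  by rewrite /gegenz -[in gegen _ n](addn0 n) -double0 coef_gegen.
have NL : 0 < N + L%:R by rewrite ltr_wpDr.
have mu0 : 0 < mu by rewrite ltr_wpDr.
have GNL : Gamma (N + L%:R) = poch mu n * Gamma mu.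
  by rewrite -(Gamma_poch _ mu0) /N /mu addrAC.
have GNL1 := GammaS NL.
have LiE : N + (L - i)%:R = N + L%:R - i%:R by rewrite natrB// addrA.
have Gi : Gamma (N + L%:R) = poch (N + L%:R - i%:R) i * (poch N (L - i) * Gamma N).
  have NLi0 : 0 < N + L%:R - i%:R by rewrite -LiE ltr_wpDr.
  by rewrite -(Gamma_poch _ N_gt0) LiE -(Gamma_poch _ NLi0) subrK.
have GN0 : Gamma N != 0 by rewrite gt_eqF// Gamma_gt0.
have G0 : Gamma (N + L%:R) != 0 by rewrite gt_eqF// Gamma_gt0.
have := G0; rewrite {1}Gi mulf_eq0 mulf_eq0 !negb_or => /and3P[p1 p2 _].
have -> : 'C(L, i)%:R = L`!%:R / (i`!%:R * (L - i)`!%:R) :> R.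
  by rewrite -(bin_fact iL) !natrM mulfK// mulf_neq0// fact_neq0.
rewrite /= mulr1n /rising /gegen_coef addn0 expr0 fact0 mul1n mul1r /Fconst /gam_const GNL1 -/mu.
have Gm : Gamma mu != 0 by rewrite gt_eqF// Gamma_gt0.
have -> : poch mu n = Gamma (N + L%:R) / Gamma mu by rewrite GNL (mulfK Gm).
have NL0 : N + L%:R != 0 by rewrite gt_eqF.
have fi := fact_neq0 R i; have fn := fact_neq0 R n; have fL := fact_neq0 R (L - i).
have e2 : (2 : R) ^+ n != 0 by rewrite expf_neq0// pnatr_eq0.
rewrite -/N.
have -> : poch (N + L%:R - i%:R) i = Gamma (N + L%:R) / (poch N (L - i) * Gamma N).
  by rewrite Gi (mulfK (mulf_neq0 p2 GN0)).
move: (Gamma (N + L%:R)) (Gamma N) (Gamma mu) (poch N i) (poch N (L - i)) GN0 G0 Gm p2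
  {GNL GNL1 Gi p1} => g gN gm p q GN0 G0 Gm p2.
by field; rewrite G0 GN0 Gm NL0 fi fn fL e2 p2.
Qed.

End explicit_polynomials.

(** * The structure matrices and the second identity *)

Section structure_matrices.
Variables (R : realType) (L : nat).

Definition tridiag (S : pzRingType) (u v : int -> S) : 'M[S]_L.+1 :=
  \matrix_(i, j) (if j == i.+1 :> nat then u i%:Z
                  else if i == j.+1 :> nat then v i%:Z else 0).

(** The function [g] extends a row by zeros to the columns -1 and L + 1, so that the first and last
    columns need no formula of their own. *)
Lemma mul_tridiag (S : pzRingType) (u v : int -> S) m (X : 'M[S]_(m, L.+1)) i (g : int -> S)
    (j : 'I_L.+1) :
  (forall j', X i j' = g j'%:Z) -> g (- 1) = 0 -> g L.+1%:Z = 0 ->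
  (X *m tridiag u v) i j = g (j%:Z - 1) * u (j%:Z - 1) + g (j%:Z + 1) * v (j%:Z + 1).
Proof.
move=> Xg g1 gL; rewrite mxE.
rewrite (eq_bigr (fun k : 'I_L.+1 => (if j == k.+1 :> nat then g k%:Z * u k%:Z else 0)
   + (if k == j.+1 :> nat then g k%:Z * v k%:Z else 0))); last first.
  move=> k _; rewrite !mxE Xg; case: eqP => [->|_]; last by case: ifP; rewrite ?mulr0 ?add0r.
  by rewrite ifF ?addr0//; lia.
rewrite big_split /= -!big_mkcond /=; congr (_ + _).
  case: (posnP j) => [j0|j0].
    rewrite big_pred0 => [|k]; last by rewrite j0.
    by rewrite j0 sub0r g1 mul0r.
  have jL : (j.-1 < L.+1)%N by have := ltn_ord j; lia.
  rewrite (big_pred1 (Ordinal jL)) => [/=|k]; last by rewrite /= -(inj_eq val_inj) /=; lia.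
  by congr (g _ * u _); lia.
have [j1L|j1L] := ltnP j.+1 L.+1.
  rewrite (big_pred1 (Ordinal j1L)) => [/=|k]; last by rewrite /= -(inj_eq val_inj).
  by congr (g _ * v _); lia.
rewrite big_pred0 => [|k]; last by have := ltn_ord k; lia.
have -> : j%:Z + 1 = L.+1%:Z by have := ltn_ord j; lia.
by rewrite gL mul0r.
Qed.

Hypothesis L_gt0 : (0 < L)%N.

Let L0 : L%:R != 0 :> R. Proof. by rewrite pnatr_eq0 -lt0n. Qed.

Let l2 : 2 * ell R L = L%:R. Proof. by rewrite /ell mulrC divfK// pnatr_eq0. Qed.

Lemma B0E : L%:R *: B0 R L = tridiag (fun z => L%:R - z%:~R) (fun z => - z%:~R).
Proof.
apply/matrixP => i j; rewrite !mxE l2 mulrA divff// mul1r.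
by rewrite -!pmulrn.
Qed.

Lemma B1E : L%:R *: B1 R L = diag_mx (\row_i (2 * i%:R - L%:R)).
Proof.
apply/matrixP => i j; rewrite !mxE.
case: (i == j); rewrite /= ?mulr1n ?mulr0n ?oppr0 ?mulr0// /ell.
by field.
Qed.

Lemma A0E (nu : R) : L%:R *: A0 nu L =
  diag_mx (\row_i ((L%:R + 2) * (i%:R - L%:R) + (nu - 1) * (2 * i%:R - L%:R))).
Proof.
apply/matrixP => i j; rewrite !mxE.
case: (i == j); rewrite /= ?mulr1n ?mulr0n ?oppr0 ?mulr0// /ell.
by field.
Qed.

Lemma mxcomm_diag (S : comPzRingType) n (X : 'M[S]_n) (d : 'rV[S]_n) i j :
  mxcomm X (diag_mx d) i j = X i j * (d 0 j - d 0 i).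
Proof. by rewrite /mxcomm mul_mx_diag mul_diag_mx !mxE mulrBr [d 0 i * _]mulrC. Qed.

End structure_matrices.

Lemma Fmx_mul_B0 (R : realType) (L : nat) (nu : R) (n : nat) (k : int) (i j : 'I_L.+1) :
  (0 < L)%N -> 0 < nu -> k <= n%:Z ->
  L%:R * (Fmx nu L k n *m B0 R L) i j =
  Fconst L nu n * (nu + n%:R + L%:R - k%:~R) *
    ((L%:R - j%:R + 1) * Phi L (nu + n%:R) i%:Z (j%:Z - 1) k
     - (j%:R + 1) * Phi L (nu + n%:R) i%:Z (j%:Z + 1) k).
Proof.
move=> L0 nu0 kn; have -> : L%:R * (Fmx nu L k n *m B0 R L) i j =
    (Fmx nu L k n *m (L%:R *: B0 R L)) i j.
  rewrite ![(_ *m _) i j]mxE mulr_sumr; apply: eq_bigr => s _.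
  by rewrite [in RHS]mxE mulrCA.
rewrite B0E// (@mul_tridiag _ _ _ _ _ _ _ (fun z => Fconst L nu n *
  (nu + n%:R + L%:R - k%:~R) * Phi L (nu + n%:R) i%:Z z k)).
- rewrite !(intrD, intrB) -!pmulrn; ring.
- by move=> j'; rewrite FmxE.
- by rewrite Phi_col_eq0 ?mulr0//; left.
- by rewrite Phi_col_eq0 ?mulr0//; right; lia.
Qed.

(** The scalar denominators cancel the factors N + L - k and N + L - k + 2 of the two F's, and they
    are nonzero since k <= n. Commuting with a diagonal matrix multiplies an entry by a difference
    of diagonal entries, so each entry is a linear relation between values of [Phi]. *)
Lemma Fmx_commutator (R : realType) (L : nat) (nu : R) (n : nat) (k : int) :
  (0 < L)%N -> 0 < nu -> k <= n%:Z ->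
  mxcomm ((nu + L%:R + n%:R - k%:~R + 2)^-1 *: Fmx nu L (k - 2) n)
    ((2 - k%:~R + 2 * nu + 2 * L%:R) *: B1 R L - 2 *: A0 nu L)
  + mxcomm ((nu + L%:R + n%:R - k%:~R)^-1 *: Fmx nu L k n)
      ((2 * n%:R - k%:~R) *: B1 R L + 2 *: A0 nu L)
  = 2 *: ((B0 R L)^T *m Fmx nu L (k - 1) n - Fmx nu L (k - 1) n *m B0 R L).
Proof.
move=> L_gt0 nu_gt0 kn.
have L0 : L%:R != 0 :> R by rewrite pnatr_eq0 -lt0n.
have B1' : B1 R L = diag_mx (L%:R^-1 *: \row_i (2 * i%:R - L%:R)).
  by rewrite linearZ /= -B1E// scalerA mulVf// scale1r.
have A0' : A0 nu L = diag_mx (L%:R^-1 *: \row_i ((L%:R + 2) * (i%:R - L%:R) + (nu - 1) * (2 * i%:R - L%:R))).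
  by rewrite linearZ /= -A0E// scalerA mulVf// scale1r.
have kR : k%:~R <= n%:R :> R by rewrite pmulrn ler_int.
have L_ge0 : 0 <= L%:R :> R by [].
have M0 : nu + L%:R + n%:R - k%:~R != 0 by rewrite gt_eqF//; lra.
have M2 : nu + L%:R + n%:R - k%:~R + 2 != 0 by rewrite gt_eqF//; lra.
rewrite B1' A0' -!linearZ /= -linearB -linearD /=.
have -> : (B0 R L)^T *m Fmx nu L (k - 1) n = (Fmx nu L (k - 1) n *m B0 R L)^T.
  by rewrite trmx_mul Fmx_sym//; lia.
have k1n : k - 1 <= n%:Z by lia.
have k2n : k - 2 <= n%:Z by lia.
have FB (i j : 'I_L.+1) := Fmx_mul_B0 i j L_gt0 nu_gt0 k1n.
have F0E (i j : 'I_L.+1) := FmxE nu_gt0 i j kn; have F2E (i j : 'I_L.+1) := FmxE nu_gt0 i j k2n.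
move: (Fmx nu L (k - 1) n *m B0 R L) (Fmx nu L k n) (Fmx nu L (k - 2) n) FB F0E F2E.
move=> FB F0 F2 FBE F0E F2E; apply/matrixP => i j.
rewrite [LHS]mxE !mxcomm_diag !mxE.
apply: (mulfI L0); rewrite [RHS]mulrCA [L%:R * (_ - _)]mulrBr !FBE F0E F2E.
have := Phi_rel1 L (nu + n%:R) i%:Z j%:Z k; have := Phi_rel2 L (nu + n%:R) i%:Z j%:Z k.
have := Phi_rel1 L (nu + n%:R) j%:Z i%:Z k; have := Phi_rel2 L (nu + n%:R) j%:Z i%:Z k.
rewrite !(Phi_sym _ _ j%:Z i%:Z).
move: (Phi _ _ i%:Z j%:Z k) (Phi _ _ i%:Z j%:Z (k - 2)) => p0 p2.
move: (Phi _ _ _ _ _) (Phi _ _ _ _ _) (Phi _ _ _ _ _) (Phi _ _ _ _ _) => q1 q2 q3 q4.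
rewrite !(intrD, intrB) -!pmulrn; move: (Fconst L nu n) => Fc r4 r3 r2 r1.
transitivity (Fc * (p2 * ((2 - k%:~R + 2 * nu + 2 * L%:R) * (2 * j%:R - 2 * i%:R)
   - 2 * ((L%:R + 2) * (j%:R - i%:R) + (nu - 1) * (2 * j%:R - 2 * i%:R)))
   + p0 * ((2 * n%:R - k%:~R) * (2 * j%:R - 2 * i%:R)
   + 2 * ((L%:R + 2) * (j%:R - i%:R) + (nu - 1) * (2 * j%:R - 2 * i%:R))))).
  by field; rewrite L0 M0 M2.
rewrite -!mulrA -!mulrBr [RHS]mulrCA; congr (_ * _).
lra.
Qed.

(** * Two symmetric operators *)

Ltac module_ring :=
  repeat match goal with |- context [?A *m ?B] => move: (A *m B) => ? end;
  apply/matrixP => ? ?; rewrite !mxE; ring.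

Section matrix_derivation.
Variable R : realType.

Definition derivmx m n (A : 'M[{poly R}]_(m, n)) : 'M[{poly R}]_(m, n) := map_mx (@deriv R) A.

Lemma derivmxM m n p (A : 'M[{poly R}]_(m, n)) (B : 'M[{poly R}]_(n, p)) :
  derivmx (A *m B) = derivmx A *m B + A *m derivmx B.
Proof.
apply/matrixP => i j; rewrite !mxE raddf_sum -big_split /=.
by apply: eq_bigr => k _; rewrite !mxE derivM.
Qed.

Lemma derivmx_tr m n (A : 'M[{poly R}]_(m, n)) : derivmx A^T = (derivmx A)^T.
Proof. by rewrite /derivmx map_trmx. Qed.

Definition pearsonmx (nu : R) m n (A : 'M[{poly R}]_(m, n)) :=
  (1 - 'X^2 : {poly R}) *: derivmx A - ((2 * nu + 1)%:P * 'X) *: A.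

Lemma pearsonmxE nu m n (A : 'M[{poly R}]_(m, n)) i j :
  pearsonmx nu A i j = pearson nu (A i j).
Proof. by rewrite !mxE /pearson -mul_polyC mulrA. Qed.

End matrix_derivation.

Lemma pearsonZ (R : realType) (nu c : R) p : pearson nu (c *: p) = c *: pearson nu p.
Proof. by rewrite /pearson derivZ -!mul_polyC; ring. Qed.

Section symmetric_operators.
Variables (R : realType) (L : nat) (nu : R).
Hypothesis nu_gt0 : 0 < nu.
Notation mxp := 'M[{poly R}]_L.+1.
Implicit Types P Q : mxp.

Definition weight_poly : mxp := \matrix_(i, j) wpoly nu L i j.
Notation Z := weight_poly.

Lemma weight_poly_tr : Z^T = Z.
Proof. by apply/matrixP => i j; rewrite !mxE wpolyC. Qed.

Definition wform P Q : 'M[R]_L.+1 := map_mx (gint nu) (P *m Z *m Q^T).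

(** The diagonal of L A_0; likewise [op1_lead] is L (x B_1 + B_0). The factor L clears the
    denominators. *)
Definition op1_diag : 'rV[R]_L.+1 :=
  \row_i ((L%:R + 2) * (i%:R - L%:R) + (nu - 1) * (2 * i%:R - L%:R)).
Definition op1_lead : mxp :=
  'X *: diag_mx (\row_i (2 * i%:R - L%:R)%:P)
  + tridiag L (fun z => (L%:R - z%:~R)%:P) (fun z => (- z%:~R)%:P).
Definition op1 P : mxp := derivmx P *m op1_lead + P *m diag_mx (map_mx polyC op1_diag).

Definition op2_diag : 'rV[R]_L.+1 := \row_i (i%:R * (L%:R - i%:R)).
Definition op2_mid : mxp := tridiag L (fun z => (L%:R - z%:~R)%:P) (fun z => z%:~R%:P).
Definition op2 P : mxp :=
  (1 - 'X^2 : {poly R}) *: derivmx (derivmx P) - ((L%:R + 2 * nu + 1)%:P * 'X) *: derivmx P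
  + derivmx P *m op2_mid + P *m diag_mx (map_mx polyC op2_diag).

(** The skew matrix S with [op1_lead] Z = (1 - x^2) S. The factor i - j also removes the diagonal,
    where [wpolyT] is no Pearson preimage; [skew2] plays the same part for the second operator. *)
Definition skew1 : mxp :=
  \matrix_(i, j) (((L%:R + 2 * nu) * (i%:R - j%:R)) *: wpolyT nu L i j).
Definition skew2 : mxp :=
  \matrix_(i, j) ((- (i%:R - j%:R) * (L%:R - i%:R - j%:R)) *: wpolyT nu L i j).

Lemma skew1_tr : skew1^T = - skew1.
Proof. by apply/matrixP => i j; rewrite !mxE wpolyTC -scaleNr; congr (_ *: _); ring. Qed.

Lemma skew2_tr : skew2^T = - skew2.
Proof. by apply/matrixP => i j; rewrite !mxE wpolyTC -scaleNr; congr (_ *: _); ring. Qed.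

Let wpoly_gt j : (j <= L)%N -> wpoly nu L L.+1 j = 0.
Proof.
move=> jL; rewrite /wpoly big1// => k _; rewrite /wterm ifF ?scale0r//.
by apply/negbTE; rewrite /wguard; have := ltn_ord k; lia.
Qed.

Let trd_mulZ (u v : int -> {poly R}) (i j : 'I_L.+1) :
  (tridiag L u v *m Z) i j = u i%:Z * wpoly nu L i.+1 j
   + (if nat_of_ord i is 0%N then 0 else v i%:Z * wpoly nu L i.-1 j).
Proof.
rewrite mxE (eq_bigr (fun k : 'I_L.+1 =>
     (if k == i.+1 :> nat then u i%:Z * wpoly nu L k j else 0)
     + (if i == k.+1 :> nat then v i%:Z * wpoly nu L k j else 0))); last first.
  move=> k _; rewrite !mxE; case: eqP => [->|_]; last by case: ifP; rewrite ?mul0r ?add0r.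
  by rewrite ifF ?addr0//; lia.
rewrite big_split /= -!big_mkcond /=; congr (_ + _).
  have [iL|iL] := ltnP i.+1 L.+1.
    rewrite (big_pred1 (Ordinal iL)) => [//=|k].
    by rewrite /= -(inj_eq val_inj).
  rewrite big_pred0 => [|k]; last by apply/negbTE; have := ltn_ord k; lia.
  have -> : i.+1 = L.+1 by have := ltn_ord i; lia.
  have /wpoly_gt -> : (j <= L)%N by rewrite -ltnS.
  by rewrite mulr0.
case: (nat_of_ord i) (ltn_ord i) => [|m] mL; first by rewrite big_pred0.
rewrite (big_pred1 (Ordinal (ltnW mL))) => [//=|k].
by rewrite eq_sym /= -(inj_eq val_inj) /= eqSS.
Qed.

Lemma op1_lead_weight : op1_lead *m Z = (1 - 'X^2 : {poly R}) *: skew1.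
Proof.
apply/matrixP => i j; rewrite mulmxDl mxE trd_mulZ -scalemxAl mul_diag_mx !mxE.
rewrite -scalerAr -wpoly_E//; [|by rewrite -ltnS|by rewrite -ltnS].
rewrite -!mul_polyC natrB; last by rewrite -ltnS.
rewrite -[i%:~R]/(i%:R).
case: (nat_of_ord i) => [|m]; first by rewrite /=; ring.
rewrite /=; ring.
Qed.

Lemma op1_diag_weight :
  diag_mx (map_mx polyC op1_diag) *m Z - Z *m diag_mx (map_mx polyC op1_diag) = pearsonmx nu skew1.
Proof.
apply/matrixP => i j; rewrite pearsonmxE mul_mx_diag mul_diag_mx !mxE.
have [->|ij] := eqVneq i j.
  by rewrite subrr mulr0 scale0r /pearson deriv0 !mulr0 scaler0 subr0 mulrC subrr.
rewrite pearsonZ pearson_wpolyT// -mul_polyC; ring.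
Qed.

Lemma op2_mid_weight : op2_mid *m Z =
  (1 - 'X^2 : {poly R}) *: derivmx Z + (L%:R%:P * 'X) *: Z - (1 - 'X^2 : {poly R}) *: skew2.
Proof.
apply/matrixP => i j; rewrite trd_mulZ !mxE.
have iL : (i <= L)%N by rewrite -ltnS.
have jL : (j <= L)%N by rewrite -ltnS.
have := wpoly_D nu_gt0 iL jL; rewrite -!mul_polyC natrB; last by rewrite -ltnS.
rewrite -[i%:~R]/(i%:R) => h.
transitivity ((L%:R - i%:R)%:P * wpoly nu L i.+1 j + (i%:R)%:P * wpoly nu L i.-1 j).
  by case: (nat_of_ord i) => [|m]; rewrite /=; ring.
rewrite h; ring.
Qed.

Lemma op2_diag_weight :
  Z *m diag_mx (map_mx polyC op2_diag) - diag_mx (map_mx polyC op2_diag) *m Z = pearsonmx nu skew2.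
Proof.
apply/matrixP => i j; rewrite pearsonmxE mul_mx_diag mul_diag_mx !mxE.
have [->|ij] := eqVneq i j.
  by rewrite subrr oppr0 mul0r scale0r /pearson deriv0 !mulr0 scaler0 subr0 mulrC subrr.
rewrite pearsonZ pearson_wpolyT// -mul_polyC; ring.
Qed.

Lemma gintB (p q : {poly R}) : gint nu (p - q) = gint nu p - gint nu q.
Proof. by rewrite gintD// -scaleN1r gintZ// mulN1r. Qed.

Lemma map_gint_pearson m n (A B C : 'M[{poly R}]_(m, n)) :
  A - B = pearsonmx nu C -> map_mx (gint nu) A = map_mx (gint nu) B.
Proof.
move=> /matrixP AB; apply/matrixP => i j; rewrite !mxE.
apply/eqP; rewrite -subr_eq0 -gintB; have := AB i j; rewrite pearsonmxE !mxE => ->.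
by rewrite gint_pearson.
Qed.

Let trmxD (A B : mxp) : (A + B)^T = A^T + B^T. Proof. exact: raddfD. Qed.
Let trmxN (A : mxp) : (- A)^T = - A^T. Proof. exact: raddfN. Qed.
Let trmxZ (c : {poly R}) (A : mxp) : (c *: A)^T = c *: A^T. Proof. exact: linearZ. Qed.

(** With M = [op1_lead], A the diagonal part and S = [skew1], one has M Z = (1 - x^2) S, Z M^T = -
    (1 - x^2) S, and A Z - Z A is the Pearson image of S. By the product rule the integrands differ
    by the Pearson image of P S Q^T, whose integral is 0. *)
Lemma op1_sym P Q : wform (op1 P) Q = wform P (op1 Q).
Proof.
apply: (@map_gint_pearson _ _ _ _ (P *m skew1 *m Q^T)).
have leadr : Z *m op1_lead^T = - ((1 - 'X^2 : {poly R}) *: skew1).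
  by rewrite -{1}weight_poly_tr -trmx_mul op1_lead_weight trmxZ skew1_tr scalerN.
rewrite /op1 trmxD !trmx_mul tr_diag_mx -derivmx_tr.
move: op1_lead op1_lead_weight leadr op1_diag_weight => M leadl leadr.
move: (diag_mx _) => A diag.
have mid : P *m A *m Z *m Q^T = P *m Z *m A *m Q^T + P *m pearsonmx nu skew1 *m Q^T.
  by rewrite -diag mulmxBr mulmxBl !mulmxA addrC subrK.
rewrite mulmxDr !mulmxDl -(mulmxA (derivmx P)) leadl mulmxA -(mulmxA P _ M^T) leadr mulmxA mid.
rewrite /pearsonmx !derivmxM; set w := (1 - 'X^2 : {poly R}); set c := _ * 'X.
rewrite mulmxBr mulmxBl mulmxN mulNmx !mulmxDl -!scalemxAr -!scalemxAl.
module_ring.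
Qed.

Lemma op2_sym P Q : wform (op2 P) Q = wform P (op2 Q).
Proof.
pose w : {poly R} := 1 - 'X^2; pose c : {poly R} := (2 * nu + 1)%:P * 'X.
pose D1 := derivmx P; pose D2 := derivmx D1.
pose E1 := derivmx Q^T; pose E2 := derivmx E1; pose Z' := derivmx Z.
pose V := diag_mx (map_mx polyC op2_diag).
have lead : (L%:R + 2 * nu + 1)%:P * 'X = L%:R%:P * 'X + c :> {poly R}.
  by rewrite -mulrDl -polyCD -!addrA.
have midr : Z *m op2_mid^T = w *: Z' + (L%:R%:P * 'X) *: Z + w *: skew2.
  rewrite -{1}weight_poly_tr -trmx_mul op2_mid_weight !trmxD trmxN !trmxZ skew2_tr scalerN opprK.
  by rewrite -derivmx_tr weight_poly_tr.
have left : op2 P *m Z *m Q^T = w *: (D2 *m Z *m Q^T) + w *: (D1 *m Z' *m Q^T)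
    - c *: (D1 *m Z *m Q^T) - w *: (D1 *m skew2 *m Q^T) + P *m V *m Z *m Q^T.
  rewrite /op2 lead -/V -/D1 -/D2; move: op2_mid op2_mid_weight => M midl.
  rewrite !mulmxDl !mulNmx -(mulmxA D1) midl mulmxBr mulmxDr mulmxBl mulmxDl -/w -/Z'.
  rewrite -!scalemxAr -!scalemxAl.
  module_ring.
have right : P *m Z *m (op2 Q)^T = w *: (P *m Z *m E2) + w *: (P *m Z' *m E1)
    - c *: (P *m Z *m E1) + w *: (P *m skew2 *m E1) + P *m Z *m V *m Q^T.
  rewrite /op2 lead !trmxD trmxN !trmxZ !trmx_mul tr_diag_mx -/V -!derivmx_tr -/E1 -/E2.
  move: (op2_mid^T) midr => M midr.
  rewrite !mulmxDr mulmxN (mulmxA _ _ E1) -(mulmxA P _ M) midr -/w !mulmxDr !mulmxDl.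
  rewrite -!scalemxAr -!scalemxAl mulmxA.
  module_ring.
(* The usual concomitant P' Z Q^T - P Z (Q^T)' of a second order operator, corrected by the skew
   part of [op2_mid] Z. *)
apply: (@map_gint_pearson _ _ _ _ (D1 *m Z *m Q^T - P *m Z *m E1 - P *m skew2 *m Q^T)).
have mid : P *m Z *m V *m Q^T = P *m V *m Z *m Q^T
    + (w *: (P *m derivmx skew2 *m Q^T) - c *: (P *m skew2 *m Q^T)).
  transitivity (P *m V *m Z *m Q^T + P *m pearsonmx nu skew2 *m Q^T).
    by rewrite -op2_diag_weight mulmxBr mulmxBl !mulmxA addrC subrK.
  by rewrite /pearsonmx -/w -/c mulmxBr mulmxBl -!scalemxAr -!scalemxAl.
have derivmxB (A B : mxp) : derivmx (A - B) = derivmx A - derivmx B by exact: raddfB.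
rewrite left right mid /pearsonmx -/w -/c !derivmxB !derivmxM.
rewrite -/D1 -/D2 -/E1 -/E2 -/Z' !mulmxDl.
module_ring.
Qed.

End symmetric_operators.

(** * Eigenfunctions and orthogonality *)

(* Up to constants the two eigenvalues are [u v / 2] and [- (u^2 + v^2) / 4] with
   [u = 2 n + l + 2 nu] and [v = 2 i - l]; as [`|v| < u], they determine [u]. *)
Lemma joint_spectrum (R : realDomainType) (nu n m i j l : R) :
  0 < nu -> 0 <= n -> 0 <= m -> 0 <= i <= l -> 0 <= j <= l ->
  (l + 2) * (i - l) + (nu - 1) * (2 * i - l) + n * (2 * i - l) =
  (l + 2) * (j - l) + (nu - 1) * (2 * j - l) + m * (2 * j - l) ->
  i * (l - i) - n * (n + l + 2 * nu) = j * (l - j) - m * (m + l + 2 * nu) -> n = m.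
Proof.
move=> nu0 n0 m0 /andP[i0 il] /andP[j0 jl] e1 e2.
have sq (a b : R) : 0 <= a -> 0 <= b -> a ^+ 2 = b ^+ 2 -> a = b.
  by move=> a0 b0 /eqP; rewrite eqrXn2// => /eqP.
have s : 2 * n + 2 * nu + 2 * i = 2 * m + 2 * nu + 2 * j.
  by apply: sq; lra.
have d : 2 * n + 2 * l + 2 * nu - 2 * i = 2 * m + 2 * l + 2 * nu - 2 * j.
  by apply: sq; lra.
lra.
Qed.

Section eigenfunctions.
Variables (R : realType) (L : nat) (nu : R).
Hypothesis nu_gt0 : 0 < nu.
Notation mxp := 'M[{poly R}]_L.+1.
Notation wform := (wform nu).
Notation polymx := (map_mx (@polyC R)).

Definition gegenmx n : mxp := \matrix_(i, j) symgegen L nu n i%:Z j%:Z.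

Lemma gegenmx_tr n : (gegenmx n)^T = gegenmx n.
Proof. by apply/matrixP => i j; rewrite !mxE symgegen_sym. Qed.

Definition op1_eigen n : 'rV[R]_L.+1 :=
  op1_diag L nu + n%:R *: \row_i (2 * i%:R - L%:R).

Definition op2_eigen n : 'rV[R]_L.+1 :=
  op2_diag R L - const_mx (n%:R * (n%:R + L%:R + 2 * nu)).

Let gegenmx_tridiag n (u v : int -> {poly R}) (i j : 'I_L.+1) :
  (derivmx (gegenmx n) *m tridiag L u v) i j =
    (symgegen L nu n i%:Z (j%:Z - 1))^`() * u (j%:Z - 1)
    + (symgegen L nu n i%:Z (j%:Z + 1))^`() * v (j%:Z + 1).
Proof.
rewrite (@mul_tridiag _ _ _ _ _ _ _ (fun z => (symgegen L nu n i%:Z z)^`()))//.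
- by move=> j'; rewrite !mxE.
- by rewrite symgegen_col_eq0 ?deriv0//; left.
- by rewrite symgegen_col_eq0 ?deriv0//; right; lia.
Qed.

Lemma op1_gegenmx n : op1 nu (gegenmx n) = diag_mx (polymx (op1_eigen n)) *m gegenmx n.
Proof.
apply/matrixP => i j; rewrite /op1 mulmxDr mxE [X in X + _]mxE gegenmx_tridiag.
rewrite -scalemxAr mul_mx_diag mul_mx_diag mul_diag_mx !mxE.
have /eqP := symgegen_E L n nu_gt0 i%:Z j%:Z; rewrite addr_eq0 -!pmulrn => /eqP E.
rewrite -!mul_polyC in E *.
rewrite !(intrD, intrB) -!pmulrn.
transitivity ((2 * j%:R - L%:R)%:P * ('X * (symgegen L nu n i j)^`()) +
    (L%:R - j%:R + 1)%:P * (symgegen L nu n i (j%:Z - 1))^`() -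
    (j%:R + 1)%:P * (symgegen L nu n i (j%:Z + 1))^`()
    + ((L%:R + 2) * (j%:R - L%:R) + (nu - 1) * (2 * j%:R - L%:R))%:P * symgegen L nu n i j); first ring.
rewrite E; ring.
Qed.

Lemma op2_gegenmx n : op2 nu (gegenmx n) = diag_mx (polymx (op2_eigen n)) *m gegenmx n.
Proof.
apply/matrixP => i j; rewrite /op2 mxE [X in X + _]mxE gegenmx_tridiag.
rewrite mul_mx_diag mul_diag_mx !mxE.
have := symgegen_D L n nu_gt0 i%:Z j%:Z; rewrite -!pmulrn => E.
rewrite -!mul_polyC in E *.
rewrite !(intrD, intrB) -!pmulrn polyCB -E; ring.
Qed.

Let gint_sum n (F : 'I_n -> {poly R}) : gint nu (\sum_i F i) = \sum_i gint nu (F i).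
Proof.
elim/big_rec2: _ => [|i x y _ <-]; last by rewrite gintD.
by rewrite -(scale0r 0) gintZ// mul0r.
Qed.

Lemma map_gintM m n (C : 'M[R]_(m, n)) p (A : 'M[{poly R}]_(n, p)) :
  map_mx (gint nu) (polymx C *m A) = C *m map_mx (gint nu) A.
Proof.
apply/matrixP => i j; rewrite !mxE gint_sum; apply: eq_bigr => k _.
by rewrite !mxE mul_polyC gintZ.
Qed.

Lemma wform_mull (C : 'M[R]_L.+1) (P Q : mxp) : wform (polymx C *m P) Q = C *m wform P Q.
Proof. by rewrite /wform -map_gintM !mulmxA. Qed.

Lemma wform_tr (P Q : mxp) : (wform P Q)^T = wform Q P.
Proof. by rewrite /wform map_trmx !trmx_mul trmxK weight_poly_tr mulmxA. Qed.

Lemma wform_mulr (C : 'M[R]_L.+1) (P Q : mxp) : wform P (polymx C *m Q) = wform P Q *m C^T.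
Proof. by rewrite -wform_tr wform_mull trmx_mul wform_tr. Qed.

Lemma eigen_inj n m (i j : 'I_L.+1) :
  op1_eigen n 0 i = op1_eigen m 0 j -> op2_eigen n 0 i = op2_eigen m 0 j -> n = m.
Proof.
have leL (k : 'I_L.+1) : 0 <= (k%:R : R) <= L%:R by rewrite ler0n ler_nat -ltnS ltn_ord.
rewrite !mxE => e1 e2; apply/eqP; rewrite -(eqr_nat R); apply/eqP.
exact: (joint_spectrum nu_gt0 (ler0n _ _) (ler0n _ _) (leL i) (leL j) e1 e2).
Qed.

(** By symmetry F = <Q_n, Q_m> satisfies d_n F = F d_m for the diagonal eigenvalues of both
    operators. A nonzero entry (i, j) of F would equate the i-th joint eigenvalue of Q_n with the
    j-th of Q_m. *)
Lemma gegenmx_orthogonal n m : n <> m -> wform (gegenmx n) (gegenmx m) = 0.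
Proof.
move=> nm; apply/matrixP => i j; rewrite [RHS]mxE; apply/eqP/negPn/negP => f0; apply: nm.
have := op1_sym nu_gt0 (gegenmx n) (gegenmx m).
have := op2_sym nu_gt0 (gegenmx n) (gegenmx m).
rewrite !op1_gegenmx !op2_gegenmx -!map_diag_mx !wform_mull !wform_mulr !tr_diag_mx.
have key (d d' : 'rV[R]_L.+1) (F : 'M[R]_L.+1) : F i j != 0 ->
    diag_mx d *m F = F *m diag_mx d' -> d 0 i = d' 0 j.
  move=> F0; rewrite mul_diag_mx mul_mx_diag => /matrixP/(_ i j).
  by rewrite !mxE mulrC => /(mulfI F0).
move=> /(key _ _ _ f0) e2 /(key _ _ _ f0) e1.
exact: eigen_inj e1 e2.
Qed.

End eigenfunctions.

(** * Completeness and uniqueness *)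

Section completeness.
Variables (R : realType) (L : nat) (nu : R).
Hypothesis nu_gt0 : 0 < nu.
Notation mxp := 'M[{poly R}]_L.+1.
Notation polymx := (map_mx (@polyC R)).
Notation Q := (gegenmx L nu).
Notation Z := (weight_poly L nu).

Definition mxsize_le (N : nat) (P : mxp) := forall i j, (size (P i j) <= N)%N.

Lemma Dmx_unit n : Dmx nu L n \in unitmx.
Proof.
rewrite unitmxE det_diag unitfE prodf_seq_neq0; apply/allP => i _ /=; rewrite mxE.
have iL : (i <= L)%N by rewrite -ltnS.
have iLR : i%:R <= L%:R :> R by rewrite ler_nat.
have nuL : 0 < nu + n%:R + L%:R - i%:R by rewrite -addrA ltr_wpDr ?subr_ge0// ltr_wpDr.
rewrite mulf_neq0 ?pnatr_eq0 -?lt0n ?bin_gt0// mulf_neq0 ?invr_neq0//.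
  by rewrite gt_eqF// poch_gt0// ltr_wpDr.
by rewrite gt_eqF// poch_gt0.
Qed.

Lemma gegenmx_span N (P : mxp) : mxsize_le N P ->
  exists C : nat -> 'M[R]_L.+1, P = \sum_(k < N) polymx (C k) *m Q k.
Proof.
elim: N P => [|N IH] P PN.
  exists (fun=> 0); rewrite big_ord0; apply/matrixP => i j; rewrite mxE.
  by apply/eqP; rewrite -size_poly_leq0.
(* Left division by the leading coefficient D_N of Q_N, so that A Q_N has the same coefficient of
   x^N as P. *)
pose A : 'M[R]_L.+1 := map_mx (fun p : {poly R} => p`_N) P *m invmx (Dmx nu L N).
have [|C PC] := IH (P - polymx A *m Q N); last first.
  exists (fun k => if k == N then A else C k); rewrite big_ord_recr /= eqxx.
  apply/eqP; rewrite -subr_eq; apply/eqP; rewrite PC; apply: eq_bigr => k _.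
  by rewrite ltn_eqF.
move=> i j; apply/leq_sizeP => m; rewrite leq_eqVlt => /predU1P[<-|Nm].
  rewrite 2!mxE coefB mxE coef_sum.
  have -> : \sum_(k < L.+1) (polymx A i k * Q N k j)`_N = (A *m Dmx nu L N) i j.
    rewrite mxE; apply: eq_bigr => k _.
    by rewrite [polymx A i k]mxE [Q N k j]mxE mul_polyC coefZ coef_symgegen.
  by rewrite /A mulmxKV ?Dmx_unit// mxE subrr.
rewrite 2!mxE coefB mxE coef_sum big1 ?subr0 => [|k _].
  by apply/leq_sizeP: Nm; exact: PN.
by rewrite [polymx A i k]mxE [Q N k j]mxE mul_polyC coefZ coef_symgegen_gt ?mulr0.
Qed.

Let wformDl (P P' S : mxp) : wform nu (P + P') S = wform nu P S + wform nu P' S.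
Proof.
by rewrite /wform !mulmxDl; apply/matrixP => i j; rewrite !mxE -gintD// !mxE.
Qed.

Lemma wformBl (P P' S : mxp) : wform nu (P - P') S = wform nu P S - wform nu P' S.
Proof.
by rewrite /wform !mulmxBl; apply/matrixP => i j; rewrite !mxE -gintB// !mxE.
Qed.

Let wform_suml n (F : 'I_n -> mxp) S : wform nu (\sum_i F i) S = \sum_i wform nu (F i) S.
Proof.
elim/big_rec2: _ => [|i A B _ <-]; last by rewrite wformDl.
rewrite /wform !mul0mx; apply/matrixP => i j; rewrite !mxE.
by rewrite -(scale0r 0) gintZ// mul0r.
Qed.

Let wform_sumr n (F : 'I_n -> mxp) S : wform nu S (\sum_i F i) = \sum_i wform nu S (F i).
Proof.
rewrite -wform_tr wform_suml raddf_sum; apply: eq_bigr => i _; exact: wform_tr.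
Qed.

(** U is a combination of the Q_k with k < n, hence orthogonal to Q_m for m >= n as well, and the
    Q_m span all S. *)
Lemma wform_complete n (U S : mxp) : mxsize_le n U ->
  (forall m, (m < n)%N -> wform nu U (Q m) = 0) -> wform nu U S = 0.
Proof.
move=> Un Uorth.
have orth m : wform nu U (Q m) = 0.
  have [mn|nm] := ltnP m n; first exact: Uorth.
  have [C ->] := gegenmx_span Un; rewrite wform_suml big1// => k _.
  by rewrite wform_mull// gegenmx_orthogonal ?mulmx0//; have := ltn_ord k; lia.
have [|C ->] := @gegenmx_span (\max_i \max_j size (S i j)) S.
  by move=> i j; apply: leq_trans (leq_bigmax i); exact: (leq_bigmax j).
by rewrite wform_sumr big1// => k _; rewrite wform_mulr// orth mul0mx.
Qed.

(** The test matrix S has (U Z)_(a,b) as its only entry, so that the (a, a) entry of the pairing is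
    the integral of a square. Positivity of the scalar weight suffices here. *)
Lemma wform_nondegenerate (U : mxp) : (forall S, wform nu U S = 0) -> U *m Z = 0.
Proof.
move=> U0; apply/matrixP => a b; rewrite [RHS]mxE.
apply: (gint_sqr_eq0 nu_gt0); rewrite expr2.
pose S : mxp := \matrix_(i, j) (if (i == a) && (j == b) then (U *m Z) a b else 0).
have /matrixP/(_ a a) := U0 S; rewrite [RHS]mxE [LHS]mxE [X in gint nu X]mxE.
rewrite (bigD1 b)//= big1 ?addr0 => [|k kb].
  by rewrite [S^T _ _]mxE [S _ _]mxE !eqxx.
by rewrite [S^T _ _]mxE [S _ _]mxE (negPf kb) andbF mulr0.
Qed.

(** The coefficient of x^(N + L) in U Z is the product of the top coefficients. That of Z is
    antidiagonal, so column L - j isolates the entry (i, j) of U and the degree of U drops. *)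
Lemma mul_weight_eq0 (U : mxp) : U *m Z = 0 -> U = 0.
Proof.
move=> UZ.
have drop N : mxsize_le N.+1 U -> mxsize_le N U.
  move=> UN i j; apply/leq_sizeP => m; rewrite leq_eqVlt => /predU1P[<-|Nm]; last first.
    by apply/leq_sizeP: Nm; exact: UN.
  have /matrixP/(_ i (rev_ord j)) := UZ; rewrite [RHS]mxE mxE.
  move=> /(congr1 (fun p : {poly R} => p`_(N + L))); rewrite coef0 coef_sum.
  have jL : (j + rev_ord j = L)%N by rewrite /=; have := ltn_ord j; lia.
  have coefUZ k : (U i k * Z k (rev_ord j))`_(N + L) = (U i k)`_N * (wpoly nu L k (rev_ord j))`_L.
    have NL : (N < (N + L).+1)%N by lia.
    rewrite coefM (bigD1 (Ordinal NL))//= big1 ?addr0 ?mxE => [|s sN]; first by rewrite addKn.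
    have [sN'|sN'] := ltnP N s.
      by have /leq_sizeP-> := UN i k; rewrite ?mul0r.
    rewrite coef_wpoly_gt ?mulr0//.
    have : (s != N :> nat) by apply: contraNneq sN => sN; apply/eqP/val_inj.
    lia.
  rewrite (bigD1 j)//= coefUZ big1 ?addr0 => [/eqP|k kj].
    by rewrite mulf_eq0 => /orP[/eqP//|]; rewrite (negPf (coef_wpoly_antidiag nu_gt0 jL)).
  rewrite coefUZ coef_wpoly_off ?mulr0//.
  by apply: contraNneq kj => kL; apply/eqP/val_inj => /=; move: jL kL => /=; lia.
have U0 : mxsize_le 0 U.
  have : mxsize_le (\max_i \max_j size (U i j)) U.
    by move=> i j; apply: leq_trans (leq_bigmax i); exact: (leq_bigmax j).
  by elim: (\max_i _)%N => // N IH /drop.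
by apply/matrixP => i j; rewrite mxE; apply/eqP; rewrite -size_poly_leq0.
Qed.

Lemma wform_unique n (U : mxp) : mxsize_le n U ->
  (forall m, (m < n)%N -> wform nu U (Q m) = 0) -> U = 0.
Proof.
move=> Un orth; apply/mul_weight_eq0/wform_nondegenerate => S.
exact: wform_complete Un orth.
Qed.

End completeness.

(** * The monic polynomials and the first identity *)

Local Open Scope complex_scope.

(** * Real and imaginary parts of complex matrix polynomials *)

Section parts.
Variables (R : realType) (L : nat).
Notation mxp := 'M[{poly R}]_L.+1.
Notation polymx := (map_mx (@polyC R)).
Variable f : R[i] -> R.
Hypothesis fD : forall a b, f (a + b) = f a + f b.
Hypothesis fM : forall a c, f (a * c%:C) = f a * c.

Let f0 : f 0 = 0. Proof. by rewrite -(mul0r (0%:C)) fM mulr0. Qed.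

Let f_sum n (F : 'I_n -> R[i]) : f (\sum_i F i) = \sum_i f (F i).
Proof. by elim/big_rec2: _ => [//|i x y _ <-]; rewrite fD. Qed.

(** The map f will be [Re] or [Im]. Only its real linearity matters, because the weight and the
    points of integration are real. *)
Definition mxpart (P : {poly 'M[R[i]]_L.+1}) : mxp :=
  \matrix_(i, j) \poly_(m < size P) f (P`_m i j).

Lemma coef_mxpart P i j m : (mxpart P i j)`_m = f (P`_m i j).
Proof.
rewrite mxE coef_poly; case: ltnP => // Pm.
by rewrite (nth_default _ Pm) mxE f0.
Qed.

Lemma horner_mxpart P x : map_mx f P.[(x%:C)%:M] = map_mx (horner^~ x) (mxpart P).
Proof.
apply/matrixP => i j; rewrite !mxE horner_poly horner_coef summxE f_sum.
apply: eq_bigr => m _; rewrite -rmorphXn -mulmxE mul_mx_scalar mxE mulrC.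
by rewrite -rmorphXn fM.
Qed.

Lemma map_mx_mul_mxC (X : 'M[R[i]]_L.+1) (Y : 'M[R]_L.+1) :
  map_mx f (X *m mxC Y) = map_mx f X *m Y.
Proof.
apply/matrixP => i j; rewrite !mxE f_sum; apply: eq_bigr => k _.
by rewrite !mxE fM.
Qed.

Lemma wform_mxpart (nu : R) (P : {poly 'M[R[i]]_L.+1}) (S : mxp) (i j : 'I_L.+1) : 0 < nu ->
  wform nu (mxpart P) S i j =
  \int[lebesgue_measure]_(x in `]-1, 1[)
    f ((P.[(x%:C)%:M] *m mxC (weight nu L x) *m mxC (map_mx (horner^~ x) S)^T) i j).
Proof.
move=> nu0; rewrite mxE /gint; apply: eq_Rintegral => x _.
set T := map_mx (horner^~ x) S.
have -> : P.[(x%:C)%:M] *m mxC (weight nu L x) *m mxC T^T =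
    P.[(x%:C)%:M] *m mxC (weight nu L x *m T^T) by rewrite -mulmxA /mxC map_mxM.
have := map_mx_mul_mxC P.[(x%:C)%:M] (weight nu L x *m T^T).
move=> /matrixP/(_ i j); rewrite [LHS]mxE => ->.
have -> : weight nu L x = gweight nu x *: map_mx (horner^~ x) (weight_poly L nu).
  by apply/matrixP => a b; rewrite weightE// !mxE.
rewrite horner_mxpart -scalemxAl -scalemxAr mulmxA [RHS]mxE; congr (_ * _).
by rewrite /T -[horner^~ x]/(horner_eval x) map_trmx -!map_mxM [RHS]mxE.
Qed.

End parts.

(** * Identification of the monic orthogonal polynomials *)

Section monic_orthogonal.
Local Open Scope sesquilinear_scope.
Variables (R : realType) (L : nat) (nu : R).
Hypothesis nu_gt0 : 0 < nu.
Notation mxp := 'M[{poly R}]_L.+1.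
Notation polymx := (map_mx (@polyC R)).
Notation Q := (gegenmx L nu).

Let mxBE (A B : mxp) i j : (A - B) i j = A i j - B i j. Proof. by rewrite !mxE. Qed.

Let ReD (a b : R[i]) : complex.Re (a + b) = complex.Re a + complex.Re b.
Proof. by case: a; case: b. Qed.

Let ImD (a b : R[i]) : complex.Im (a + b) = complex.Im a + complex.Im b.
Proof. by case: a; case: b. Qed.

Let ReM (a : R[i]) (c : R) : complex.Re (a * c%:C) = complex.Re a * c.
Proof. by case: a => a b /=; rewrite mulr0 subr0. Qed.

Let ImM (a : R[i]) (c : R) : complex.Im (a * c%:C) = complex.Im a * c.
Proof. by case: a => a b /=; rewrite mulr0 add0r. Qed.

Let realC (c : R) : Num.conj (c%:C : R[i]) = c%:C.
Proof. by apply: conj_Creal; rewrite complex_real. Qed.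

(** The top coefficient of [mxpart f P] is f(1) times the identity, so the difference of the two
    sides has degree below n and is orthogonal to every Q_m with m < n. With f(1) = 1 for [Re] and 0
    for [Im], both parts are covered. *)
Lemma gegenmx_monic (f : R[i] -> R) (P : {poly 'M[R[i]]_L.+1}) n :
  (forall a b, f (a + b) = f a + f b) -> (forall a c, f (a * c%:C) = f a * c) ->
  P \is monic -> size P = n.+1 ->
  (forall m, (m < n)%N -> wform nu (mxpart f P) (Q m) = 0) ->
  mxpart f P = polymx (f 1 *: invmx (Dmx nu L n)) *m Q n.
Proof.
move=> fD fM Pmonic Psize orth.
have f0 : f 0 = 0 by rewrite -(mul0r (0%:C)) fM mulr0.
apply/eqP; rewrite -subr_eq0; apply/eqP/(@wform_unique _ _ _ nu_gt0 n) => [i j|m mn].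
  apply/leq_sizeP => m; rewrite mxBE coefB coef_mxpart// [(_ *m _) _ _]mxE coef_sum => nm.
  have coefQ k : (polymx (f 1 *: invmx (Dmx nu L n)) i k * Q n k j)`_m
      = (f 1 *: invmx (Dmx nu L n)) i k * (symgegen L nu n k j)`_m.
    by rewrite [polymx _ i k]mxE [Q n k j]mxE mul_polyC coefZ.
  rewrite (eq_bigr _ (fun k _ => coefQ k)).
  have [<-|nm'] := eqVneq n m.
    have -> : P`_n = 1 by rewrite -(monicP Pmonic) /lead_coef Psize.
    under eq_bigr => k _ do rewrite coef_symgegen//.
    have := mulVmx (Dmx_unit L nu_gt0 n) => /(congr1 ( *:%R (f 1))).
    rewrite scalemxAl => /matrixP/(_ i j); rewrite mxE => ->.
    have -> : (1 : 'M[R[i]]_L.+1) i j = 1 * ((i == j)%:R : R)%:C.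
      by rewrite mul1r rmorph_nat mxE.
    by rewrite fM !mxE subrr.
  have nltm : (n < m)%N by rewrite ltn_neqAle nm'.
  rewrite nth_default ?Psize// mxE f0 big1 ?subr0// => k _.
  by rewrite coef_symgegen_gt ?mulr0.
rewrite wformBl// orth// wform_mull// gegenmx_orthogonal ?mulmx0 ?subr0//; lia.
Qed.

Lemma monic_mvGegenbauerE P : monic_mvGegenbauer nu P ->
  forall n m, (P n)`_m = mxC (invmx (Dmx nu L n) *m map_mx (coefp m) (Q n)).
Proof.
move=> [Pmonic Porth].
pose M n : mxp := polymx (invmx (Dmx nu L n)) *m Q n.
suff parts n : mxpart (@complex.Re R) (P n) = M n /\ mxpart (@complex.Im R) (P n) = 0.
  move=> n m; apply/matrixP => i j; have [reP imP] := parts n.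
  have -> : mxC (invmx (Dmx nu L n) *m map_mx (coefp m) (Q n)) i j = ((M n i j)`_m)%:C.
    rewrite !mxE coef_sum; congr (_ %:C); apply: eq_bigr => k _.
    by rewrite !mxE mul_polyC coefZ.
  rewrite -reP coef_mxpart//; apply/eqP; rewrite eq_complex /= eqxx.
  by rewrite -(coef_mxpart ImM) imP mxE coef0 eqxx.
(* Strong induction: once P_m is known to be real for m < n, its conjugate transpose is a transpose
   and the given orthogonality becomes one for [wform]. *)
elim/ltn_ind: n => n IH; have [nmonic nsize] := Pmonic n.
have conjP m x : (m < n)%N -> (P m).[(x%:C)%:M] ^t* = mxC (map_mx (horner^~ x) (M m))^T.
  move=> /IH[reP imP]; apply/matrixP => i j.
  have real_tr (S : mxp) : mxC (map_mx (horner^~ x) S)^T i j = (S j i).[x]%:C by rewrite !mxE.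
  have conj_tr (A : 'M[R[i]]_L.+1) : (A ^t*) i j = Num.conj (A j i) by rewrite !mxE.
  have := horner_mxpart ReD ReM (P m) x; have := horner_mxpart ImD ImM (P m) x.
  rewrite reP imP => /matrixP/(_ j i) + /matrixP/(_ j i); rewrite conj_tr real_tr.
  move: (M m) (P m).[_] => S A; rewrite !mxE horner0.
  by case: (A j i) => a b /= -> ->; rewrite realC.
have orth f : (forall a b, f (a + b) = f a + f b) -> (forall a c, f (a * c%:C) = f a * c) ->
    (forall m i j, n <> m -> \int[lebesgue_measure]_(x in `]-1, 1[)
      f (((P n).[(x%:C)%:M] *m mxC (weight nu L x) *m (P m).[(x%:C)%:M] ^t* ) i j) = 0) ->
    mxpart f (P n) = polymx (f 1 *: invmx (Dmx nu L n)) *m Q n.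
  move=> fD fM f0; apply: gegenmx_monic => // m mn.
  have -> : Q m = polymx (Dmx nu L m) *m M m.
    by rewrite mulmxA -map_mxM mulmxV ?Dmx_unit// map_mx1 mul1mx.
  rewrite wform_mulr//; suff -> : wform nu (mxpart f (P n)) (M m) = 0 by rewrite mul0mx.
  apply/matrixP => i j; rewrite wform_mxpart// mxE -[RHS](f0 m i j); last by lia.
  by apply: eq_Rintegral => x _; rewrite conjP.
have int0 f m i j : n <> m -> f (mx_integral `]-1, 1[ (fun x => (P n).[(x%:C)%:M]
    *m mxC (weight nu L x) *m (P m).[(x%:C)%:M] ^t* ) i j) = f 0 :> R.
  by move=> /Porth ->; rewrite mxE.
split.
  rewrite (orth _ ReD ReM) ?scale1r// => m i j /(int0 (@complex.Re R) m i j).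
  by rewrite [mx_integral _ _ _ _]mxE.
rewrite (orth _ ImD ImM) ?scale0r ?map_mx0 ?mul0mx// => m i j /(int0 (@complex.Im R) m i j).
by rewrite [mx_integral _ _ _ _]mxE.
Qed.

Lemma coef_sym_mvGegenbauer P : monic_mvGegenbauer nu P ->
  forall n m, (sym_mvGegenbauer nu P n)`_m = mxC (map_mx (coefp m) (Q n)).
Proof.
move=> PG n m; rewrite /sym_mvGegenbauer coefZ monic_mvGegenbauerE// -mulmxE /mxC -map_mxM.
by rewrite mulmxA mulmxV ?mul1mx// Dmx_unit.
Qed.

End monic_orthogonal.

(** * Evaluation of real matrix polynomials at complex points *)

Section evaluation.
Variables (R : realType) (L : nat) (x : R[i]).

(** Being a ring morphism, it carries matrix identities over the real polynomials to every complex
    x. *)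
Definition evalC : {poly R} -> R[i] := horner_morph (fun c => mulrC x (real_complex R c)).
HB.instance Definition _ := GRing.RMorphism.on evalC.

Lemma horner_mx_poly (A : {poly 'M[R[i]]_L.+1}) (B : 'M[{poly R}]_L.+1) :
  (forall m, A`_m = mxC (map_mx (coefp m) B)) -> A.[x%:M] = map_mx evalC B.
Proof.
move=> AB; apply/matrixP => i j; rewrite mxE /evalC /horner_morph.
have coefB m : A`_m i j = ((B i j)`_m)%:C by rewrite AB !mxE.
have sizeB : (size (map_poly (real_complex R) (B i j)) <= size A)%N.
  apply/leq_sizeP => m Am; rewrite coef_map /= -coefB.
  by rewrite nth_default// mxE.
rewrite (horner_coef_wide _ sizeB) horner_coef summxE; apply: eq_bigr => m _.
by rewrite -rmorphXn -mulmxE mul_mx_scalar mxE coef_map /= coefB mulrC.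
Qed.

Lemma horner_mx_poly_deriv (A : {poly 'M[R[i]]_L.+1}) (B : 'M[{poly R}]_L.+1) :
  (forall m, A`_m = mxC (map_mx (coefp m) B)) -> A^`().[x%:M] = map_mx evalC (derivmx B).
Proof.
move=> AB; apply: horner_mx_poly => m; rewrite coef_deriv AB; apply/matrixP => i j.
by rewrite mulmxnE !mxE /= coef_deriv rmorphMn.
Qed.

Lemma evalC_polyC m n (A : 'M[R]_(m, n)) : map_mx evalC (map_mx polyC A) = map_mx (real_complex R) A.
Proof. by apply/matrixP => i j; rewrite !mxE /evalC /horner_morph map_polyC hornerC. Qed.

End evaluation.

(** * The first identity *)

Section commutator_equation.
Variables (R : realType) (L : nat) (nu : R).
Hypothesis (L_gt0 : (0 < L)%N) (nu_gt0 : 0 < nu).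
Notation Q := (gegenmx L nu).
Notation polymx := (map_mx (@polyC R)).

Lemma op1_leadE : op1_lead R L = 'X *: polymx (L%:R *: B1 R L) + polymx (L%:R *: B0 R L).
Proof.
rewrite B1E// B0E// map_diag_mx /op1_lead; congr (_ *: diag_mx _ + _); apply/matrixP => i j.
  by rewrite !mxE.
by rewrite !mxE; case: ifP => // _; case: ifP.
Qed.

Lemma evalC_commutator n (x : R[i]) :
  let q := map_mx (evalC x) (Q n) in let dq := map_mx (evalC x) (derivmx (Q n)) in
  x *: mxcomm dq (mxC (B1 R L)) + dq *m mxC (B0 R L) - (mxC (B0 R L))^T *m dq
  = mxcomm (mxC (2 *: A0 nu L + n%:R *: B1 R L)) q.
Proof.
move=> q dq; have L0 : L%:R != 0 :> R[i] by rewrite pnatr_eq0 -lt0n.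
have mxCZ (c : nat) (A : 'M[R]_L.+1) : mxC (c%:R *: A) = c%:R *: mxC A.
  by rewrite /mxC map_mxZ rmorph_nat.
(* The eigenvalue equation of [op1], evaluated at x and divided by L. *)
have E : dq *m (x *: mxC (B1 R L) + mxC (B0 R L)) + q *m mxC (A0 nu L)
    = (mxC (A0 nu L) + n%:R *: mxC (B1 R L)) *m q.
  apply: (scalerI L0); rewrite [RHS]scalemxAl scalerDr !scalemxAr !scalerDr.
  have scaleCA (c : R[i]) (A : 'M[R[i]]_L.+1) : L%:R *: (c *: A) = c *: (L%:R *: A).
    by rewrite !scalerA mulrC.
  rewrite !scaleCA -!mxCZ.
  have := congr1 (map_mx (evalC x)) (op1_gegenmx L nu_gt0 n).
  have eigenE : diag_mx (polymx (op1_eigen L nu n)) =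
      polymx (L%:R *: A0 nu L + n%:R *: (L%:R *: B1 R L)).
    by rewrite B1E// A0E// -map_diag_mx /op1_eigen linearD linearZ.
  have diagE : diag_mx (polymx (op1_diag L nu)) = polymx (L%:R *: A0 nu L).
    by rewrite A0E// -map_diag_mx.
  rewrite eigenE /op1 diagE op1_leadE map_mxD !map_mxM map_mxD map_mxZ !evalC_polyC.
  have evalX : evalC x 'X = x by rewrite /evalC /horner_morph map_polyX hornerX.
  by move=> h; rewrite /mxC -map_mxD -[in X in X *: _]evalX.
have tr_diag (d : 'rV[R]_L.+1) (A : 'M[R]_L.+1) : L%:R *: A = diag_mx d -> (mxC A)^T = mxC A.
  move=> Ad; apply: (scalerI L0); rewrite -linearZ /= -mxCZ Ad /mxC map_trmx.
  by rewrite tr_diag_mx.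
have B1tr := tr_diag _ _ (B1E R L_gt0); have A0tr := tr_diag _ _ (A0E L_gt0 nu).
have qtr : q^T = q by rewrite /q map_trmx gegenmx_tr.
have dqtr : dq^T = dq by rewrite /dq map_trmx -derivmx_tr gegenmx_tr.
(* Transposition fixes q, its derivative, A_0 and B_1, reverses the products and turns B_0 into its
   transpose. Subtracting [Et] from [E] leaves the commutators; A_0 enters from both sides of [E],
   hence the coefficient 2. *)
have Et := congr1 trmx E.
rewrite !linearD /= !trmx_mul !linearD /= !linearZ /= B1tr A0tr qtr dqtr in Et.
have -> : mxC (2 *: A0 nu L + n%:R *: B1 R L) = 2 *: mxC (A0 nu L) + n%:R *: mxC (B1 R L).
  by rewrite /mxC map_mxD -!mxCZ.
move: (mxC (A0 nu L)) (mxC (B0 R L)) (mxC (B1 R L)) E Et => A B C E Et.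
rewrite /mxcomm; move: E Et; rewrite !mulmxDl !mulmxDr -!scalemxAl -!scalemxAr.
repeat match goal with |- context [?U *m ?V] => move: (U *m V) => ? end.
move=> /matrixP E /matrixP Et; apply/matrixP => i j.
move: (E i j) (Et i j); rewrite !mxE => /eqP + /eqP.
rewrite -subr_eq0 => /eqP e1; rewrite -subr_eq0 => /eqP e2.
apply/eqP; rewrite -subr_eq0; apply/eqP; rewrite -[RHS](subrr 0).
rewrite -[X in _ = X - _]e1 -[X in _ = _ - X]e2; ring.
Qed.

End commutator_equation.

Theorem proposition4p3 (R : realType) (L : nat) (nu : R)
    (L_gt0 : (0 < L)%N) (nu_gt0 : 0 < nu) :
  (forall P : nat -> {poly 'M[R[i]]_L.+1}, monic_mvGegenbauer nu P ->
   forall (n : nat) (x : R[i]),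
     let Q := (sym_mvGegenbauer nu P n).[x%:M] in
     let dQ := ((sym_mvGegenbauer nu P n)^`()).[x%:M] in
     x *: mxcomm dQ (mxC (B1 R L))
       + dQ *m mxC (B0 R L) - (mxC (B0 R L))^T *m dQ
     = mxcomm (mxC (2 *: A0 nu L + n%:R *: B1 R L)) Q)
  /\
  (forall (n : nat) (k : int), k <= n%:Z ->
     let l := ell R L in
     let kr : R := k%:~R in
     mxcomm ((nu + 2 * l + n%:R - kr + 2)^-1 *: Fmx nu L (k - 2) n)
            ((2 - kr + 2 * nu + 4 * l) *: B1 R L - 2 *: A0 nu L)
     + mxcomm ((nu + 2 * l + n%:R - kr)^-1 *: Fmx nu L k n)
              ((2 * n%:R - kr) *: B1 R L + 2 *: A0 nu L)
     = 2 *: ((B0 R L)^T *m Fmx nu L (k - 1) n - Fmx nu L (k - 1) n *m B0 R L)).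
Proof.
split=> [P PG n x /=|n k kn /=].
  have coefP := coef_sym_mvGegenbauer nu_gt0 PG n.
  by rewrite (horner_mx_poly x coefP) (horner_mx_poly_deriv x coefP) evalC_commutator.
have l2 : 2 * ell R L = L%:R by rewrite /ell mulrC divfK// pnatr_eq0.
have l4 : 4 * ell R L = 2 * L%:R by rewrite -l2; ring.
rewrite l2 l4; exact: Fmx_commutator.
Qed.
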